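(* Let $P,Q$ be Dyck paths of semilength $n$. There exists a permutation $\alpha\in S_n$ with $\lambda(\alpha)=P$ and $\mu(\alpha)=Q$ if and only if $L'(Q)\le P$ and $L'(P)\le Q$.
   Context: Dyck path of semilength $n$: lattice path from $(0,0)$ to $(2n,0)$ with steps $U=(1,1)$, $D=(1,-1)$, never below the $x$-axis. A return is a down step ending on the $x$-axis; a Dyck path is irreducible if it has exactly one return; every Dyck path factors uniquely as $P=P_1\cdots P_r$ with each $P_i$ irreducible (its irreducible components). If $P$ has ascents (maximal runs of $U$) of lengths $a_1,\dots,a_k$ and descents of lengths $d_1,\dots,d_k$ (left to right), with $A_i=a_1+\dots+a_i$, $D_i=d_1+\dots+d_i$, its ascent-descent code is $(A,D)$, $A=A_1,\dots,A_{k-1}$, $D=D_1,\dots,D_{k-1}$; this determines $P$. $P$ is irreducible iff $A_i>D_i$ for all $i$. Order $\le$: for irreducible $P,Q$ of the same semilength with $P$ having code $A=A_1,\dots,A_k$, $D=D_1,\dots,D_k$, $Q$ covers $P$ if the ascent code of $Q$ is obtained from $A$ by deleting some $A_i$ and the descent code of $Q$ is obtained from $D$ by deleting some $D_j$ with $j\ge i$. On irreducible paths, $\le$ is the reflexive-transitive closure of this covering relation. For arbitrary Dyck paths with irreducible decompositions $P=P_1\cdots P_r$, $Q=Q_1\cdots Q_s$, $P\le Q$ iff $r=s$ and $P_i\le Q_i$ for all $i$. The map $L'$: for an irreducible path $P$ of semilength $n$ with code $A=A_1,\dots,A_h$, $D=D_1,\dots,D_h$, let $\{\hat A_1>\dots>\hat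 A_{n-2-h}\}=\{1,\dots,n-2\}\setminus\{A_1-1,\dots,A_h-1\}$ and $\{\hat D_1>\dots>\hat D_{n-2-h}\}=\{1,\dots,n-2\}\setminus\{D_1,\dots,D_h\}$; $L'(P)$ is the irreducible Dyck path of semilength $n$ with code $A'_i=n-\hat A_i$, $D'_i=n-1-\hat D_i$. For a general path, $L'(P_1\cdots P_r)=L'(P_r)\cdots L'(P_1)$. For $\sigma=x_1\cdots x_n$: $x_i$ is a left-to-right (LTR) minimum if $x_i<x_j$ for all $j<i$; $x_i$ is a right-to-left (RTL) maximum if $x_i>x_j$ for all $j>i$. $\lambda(\sigma)$: write $\sigma=m_1w_1\cdots m_kw_k$ with $m_1>\dots>m_k$ the LTR minima and $w_i$ possibly empty words, $m_0=n+1$; $\lambda(\sigma)=U^{m_0-m_1}D^{|w_1|+1}\cdots U^{m_{k-1}-m_k}D^{|w_k|+1}$. $\mu(\sigma)$: write $\sigma=u_hM_h\cdots u_1M_1$ with $M_1<\dots<M_h$ the RTL maxima and $u_i$ possibly empty words, $M_0=0$; $\mu(\sigma)=U^{M_1-M_0}D^{|u_1|+1}U^{M_2-M_1}D^{|u_2|+1}\cdots U^{M_h-M_{h-1}}D^{|u_h|+1}$. *)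

(* Defs.v *)
From mathcomp Require Import all_boot all_fingroup.
From Stdlib Require Import Relations.
Set Implicit Arguments. Unset Strict Implicit. Unset Printing Implicit Defensive.

(* A lattice path is a word over bool: true = U = (1,1), false = D = (1,-1). *)
Definition U := true.
Definition D := false.

Definition nU (p : seq bool) := count id p.
Definition nD (p : seq bool) := count negb p.

Definition dyck (n : nat) (p : seq bool) : Prop :=
  [/\ size p = n.*2, nU p = nD p & forall i, nD (take i p) <= nU (take i p)].

Definition is_return (p : seq bool) (i : nat) : bool :=
  (i < size p) && (nth U p i == D) && (nU (take i.+1 p) == nD (take i.+1 p)).

Definition nreturns (p : seq bool) : nat := count (is_return p) (iota 0 (size p)).

Definition irreducible (p : seq bool) : bool := nreturns p == 1.

(* Irreducible decomposition P = P_1 ... P_r, cutting after each return.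
   h = current height, cur = current (unfinished) component. *)
Fixpoint decomp_aux (h : nat) (cur : seq bool) (p : seq bool) : seq (seq bool) :=
  match p with
  | [::] => if cur is [::] then [::] else [:: cur]
  | b :: p' =>
      if b then decomp_aux h.+1 (rcons cur b) p'
      else if h == 1 then rcons cur b :: decomp_aux 0 [::] p'
      else decomp_aux h.-1 (rcons cur b) p'
  end.
Definition decomp (p : seq bool) : seq (seq bool) := decomp_aux 0 [::] p.

Fixpoint rle (p : seq bool) : seq (bool * nat) :=
  match p with
  | [::] => [::]
  | b :: p' =>
      match rle p' with
      | (c, k) :: r => if b == c then (c, k.+1) :: r else (b, 1) :: (c, k) :: r
      | [::] => [:: (b, 1)]
      end
  end.

Definition ascents (p : seq bool) : seq nat := [seq r.2 | r <- rle p & r.1].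
Definition descents (p : seq bool) : seq nat := [seq r.2 | r <- rle p & ~~ r.1].

Fixpoint psums_aux (acc : nat) (s : seq nat) : seq nat :=
  if s is x :: s' then (acc + x) :: psums_aux (acc + x) s' else [::].
Definition psums (s : seq nat) := psums_aux 0 s.

Definition codeA (p : seq bool) : seq nat := take (size (ascents p)).-1 (psums (ascents p)).
Definition codeD (p : seq bool) : seq nat := take (size (descents p)).-1 (psums (descents p)).

Fixpoint diffs_aux (prev : nat) (s : seq nat) : seq nat :=
  if s is x :: s' then (x - prev) :: diffs_aux x s' else [::].

Definition path_of_code (m : nat) (A Dc : seq nat) : seq bool :=
  flatten [seq nseq a.1 U ++ nseq a.2 D
          | a <- zip (diffs_aux 0 (rcons A m)) (diffs_aux 0 (rcons Dc m))].

Definition covers (P Q : seq bool) : Prop :=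
  exists m, [/\ dyck m P, dyck m Q, irreducible P, irreducible Q &
    exists i j, [/\ i <= j, j < size (codeA P),
                    codeA Q = take i (codeA P) ++ drop i.+1 (codeA P) &
                    codeD Q = take j (codeD P) ++ drop j.+1 (codeD P)]].

Definition le_irr : seq bool -> seq bool -> Prop := clos_refl_trans _ covers.

Definition dle (P Q : seq bool) : Prop :=
  size (decomp P) = size (decomp Q) /\
  forall i, i < size (decomp P) -> le_irr (nth [::] (decomp P) i) (nth [::] (decomp Q) i).

Definition Lp_irr (P : seq bool) : seq bool :=
  let m := (size P)./2 in
  let Ahat := rev [seq x <- iota 1 (m - 2) | x \notin [seq a.-1 | a <- codeA P]] in
  let Dhat := rev [seq x <- iota 1 (m - 2) | x \notin codeD P] in
  path_of_code m [seq m - x | x <- Ahat] [seq m.-1 - x | x <- Dhat].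

Definition Lp (P : seq bool) : seq bool := flatten (rev (map Lp_irr (decomp P))).

Definition word n (a : 'S_n) : seq nat := [seq (a i).+1 | i <- enum 'I_n].

(* lambda: scanning sigma from left to right with the current LTR minimum
   (initially m_0 = n+1): a new LTR minimum x (< current min c) contributes
   U^{c-x} D, any other letter contributes D.  This is exactly
   U^{m_0-m_1} D^{|w_1|+1} ... U^{m_{k-1}-m_k} D^{|w_k|+1}. *)
Fixpoint lambda_aux (c : nat) (s : seq nat) : seq bool :=
  if s is x :: s' then
    if x < c then nseq (c - x) U ++ D :: lambda_aux x s'
    else D :: lambda_aux c s'
  else [::].
Definition lambda (s : seq nat) : seq bool := lambda_aux (size s).+1 s.

(* mu: scanning sigma from right to left with the current RTL maximum
   (initially M_0 = 0): a new RTL maximum x (> current max c) contributes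
   U^{x-c} D, any other letter contributes D.  This is exactly
   U^{M_1-M_0} D^{|u_1|+1} ... U^{M_h-M_{h-1}} D^{|u_h|+1}. *)
Fixpoint mu_aux (c : nat) (s : seq nat) : seq bool :=
  if s is x :: s' then
    if c < x then nseq (x - c) U ++ D :: mu_aux x s'
    else D :: mu_aux c s'
  else [::].
Definition mu (s : seq nat) : seq bool := mu_aux 0 (rev s).

(* Main.v *)
(** Read a permutation sigma of 1..m through its complement y = m+1-sigma.
    Then lambda sigma records the running maxima of y and mu sigma those of the
    reverse complement of y.  For an irreducible path with code (A, B), the path
    of y has this code iff y takes the value A_(i+1) at the (0-based) position
    B_i (with B_0 = 0, A_(k+1) = m) and is at most A_i before position B_i.

    An irreducible P lies below Q iff the code of Q is obtained from that of P by
    deleting index sets I, J of equal size with I <= J componentwise.  As the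
    code of L'(Q) consists of the values and positions not occupied by the
    right-to-left maxima prescribed by Q, the relation L'(Q) <= P says that these
    maxima are compatible with the left-to-right minima prescribed by P, and that
    a Hall-type inequality holds for the remaining letters: before each position
    B_i there are at most as many free positions as there are free values at most
    A_i.  Given both inequalities, matching the remaining positions and values of
    y monotonically respects the constraints of P and of Q simultaneously.

    A return of the path of y is the same thing as a decomposition of y as a
    direct sum, and the reverse complement of a direct sum is the direct sum of
    the reverse complements in the opposite order; this reduces the general case
    to the irreducible one. *)

Require Import Defs.
From mathcomp Require Import all_boot all_fingroup.
From mathcomp Require Import zify.
From Stdlib Require Import Relations.
Set Implicit Arguments. Unset Strict Implicit. Unset Printing Implicit Defensive.

(** * Paths and their codes *)

Definition runs (a d : seq nat) : seq bool :=
  flatten [seq nseq x.1 U ++ nseq x.2 D | x <- zip a d].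

(** Positive run lengths keep neighbouring runs from merging, so that [rle] recovers the lists from
    which [runs] builds a path. *)
Definition pos (s : seq nat) := all (leq 1) s.

Lemma nU_cat p q : nU (p ++ q) = nU p + nU q.
Proof. exact: count_cat. Qed.

Lemma nD_cat p q : nD (p ++ q) = nD p + nD q.
Proof. exact: count_cat. Qed.

Lemma nU_nseq k b : nU (nseq k b) = b * k.
Proof. exact: count_nseq. Qed.

Lemma nD_nseq k b : nD (nseq k b) = (~~ b) * k.
Proof. exact: count_nseq. Qed.

Lemma size_nUD p : size p = nU p + nD p.
Proof. by rewrite -(count_predC id p). Qed.

Lemma runs_cons x a y d :
  runs (x :: a) (y :: d) = nseq x U ++ nseq y D ++ runs a d.
Proof. by rewrite /runs /= catA. Qed.

Lemma nU_runs a d : size a = size d -> nU (runs a d) = sumn a.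
Proof.
elim: a d => [|x a IH] [|y d] //= [sz].
by rewrite runs_cons !nU_cat !nU_nseq IH //= /U; lia.
Qed.

Lemma nD_runs a d : size a = size d -> nD (runs a d) = sumn d.
Proof.
elim: a d => [|x a IH] [|y d] //= [sz].
by rewrite runs_cons !nD_cat !nD_nseq IH //= /U; lia.
Qed.

(** The induction on letters needs the leading block of down steps, since the tail of a path may
    start with [D]. The default in [last D p] admits the empty word. *)
Lemma runs_exists p : last D p = D ->
  exists y a d, [/\ p = nseq y D ++ runs a d, size a = size d, pos a & pos d].
Proof.
elim: p => [|b p IH] //=; first by exists 0, [::], [::].
case: b => lastp; last first.
  have [|y [a [d [-> sz pa pd]]]] := IH; first by case: p lastp {IH}.
  by exists y.+1, a, d.
case: p IH lastp => [|b p] // IH lastp.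
have [//|y [a [d [Ep sz pa pd]]]] := IH.
(* If down steps follow, the new up step forms an ascent of length 1 and they become the first
   descent; otherwise it lengthens the first ascent. *)
case: y Ep => [|y] Ep; last first.
  by exists 0, (1 :: a), (y.+1 :: d); rewrite runs_cons /= sz Ep; split.
case: a d sz pa pd Ep => [|x a] [|z d] // sz pa pd Ep.
case: sz => sz; rewrite Ep; case/andP: pa => _ pa.
by exists 0, (x.+1 :: a), (z :: d); split; rewrite //= sz.
Qed.

Lemma rle_block b k r : ohead r != Some b -> 0 < k ->
  rle (nseq k b ++ r) = (b, k) :: rle r.
Proof.
move=> hr; case: k => // k _; elim: k => [|k IH] /=.
  case: r hr => [|c r] //= hr.
  have [k [t Et]] : exists k t, rle (c :: r) = (c, k) :: t.
    rewrite /=; case: (rle r) => [|[e k] t]; first by exists 1, [::].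
    by case: eqP => [->|_]; [exists k.+1, t | exists 1, ((e, k) :: t)].
  move: Et; rewrite /= => ->; case: eqP => // Ebc.
  by rewrite Ebc eqxx in hr.
by rewrite /= in IH; rewrite IH eqxx.
Qed.

Lemma ohead_runs a d : pos a -> ohead (runs a d) != Some D.
Proof. by case: a d => [|[|x] a] [|y d]. Qed.

Lemma rle_runs a d : size a = size d -> pos a -> pos d ->
  rle (runs a d) = flatten [seq [:: (U, x.1); (D, x.2)] | x <- zip a d].
Proof.
elim: a d => [|x a IH] [|y d] //= [sz] /andP[x0 pa] /andP[y0 pd].
rewrite runs_cons rle_block //; last by case: y y0.
by rewrite rle_block ?ohead_runs // IH.
Qed.

Lemma ascents_runs a d : size a = size d -> pos a -> pos d ->
  ascents (runs a d) = a.
Proof.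
move=> sz pa pd; rewrite /ascents rle_runs // {pa pd}.
by elim: a d sz => [|x a IH] [|y d] //= [sz]; rewrite IH.
Qed.

Lemma descents_runs a d : size a = size d -> pos a -> pos d ->
  descents (runs a d) = d.
Proof.
move=> sz pa pd; rewrite /descents rle_runs // {pa pd}.
by elim: a d sz => [|x a IH] [|y d] //= [sz]; rewrite IH.
Qed.

Lemma size_psums_aux c s : size (psums_aux c s) = size s.
Proof. by elim: s c => //= x s IH c; rewrite IH. Qed.

Lemma size_diffs_aux c s : size (diffs_aux c s) = size s.
Proof. by elim: s c => //= x s IH c; rewrite IH. Qed.

Lemma psums_auxK c s : diffs_aux c (psums_aux c s) = s.
Proof. by elim: s c => //= x s IH c; rewrite addKn IH. Qed.

Lemma diffs_auxK c s : path ltn c s -> psums_aux c (diffs_aux c s) = s.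
Proof.
by elim: s c => //= x s IH c /andP[cx px]; rewrite subnKC ?IH // ltnW.
Qed.

Lemma pos_diffs c s : path ltn c s -> pos (diffs_aux c s).
Proof. by elim: s c => //= x s IH c /andP[cx px]; rewrite IH // subn_gt0 cx. Qed.

Lemma path_psums c s : pos s -> path ltn c (psums_aux c s).
Proof.
by elim: s c => //= x s IH c /andP[x0 ps]; rewrite IH // andbT -addn1 leq_add2l.
Qed.

Lemma last_psums c s : last c (psums_aux c s) = c + sumn s.
Proof. by elim: s c => [|x s IH] c /=; rewrite ?addn0 // IH addnA. Qed.

Lemma sumn_diffs c s : path ltn c s -> c + sumn (diffs_aux c s) = last c s.
Proof. by move=> p; rewrite -last_psums diffs_auxK. Qed.

Lemma rcons_psums s : s != [::] ->
  rcons (take (size s).-1 (psums s)) (sumn s) = psums s.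
Proof.
case/lastP: s => // s x _; rewrite size_rcons /=.
have /= := last_psums 0 (rcons s x); have := size_psums_aux 0 (rcons s x).
rewrite size_rcons -/(psums _); case/lastP: (psums _) => // t y.
rewrite size_rcons => -[<-]; rewrite last_rcons => ->.
by rewrite add0n -[in take _ _]cats1 take_size_cat.
Qed.

(** Irreducibility in the form used below: the path stays strictly above the axis between its ends.
    [prime_dyckP] relates it to having exactly one return. *)
Definition prime_dyck m (p : seq bool) : Prop :=
  [/\ size p = m.*2, nU p = nD p, 0 < m &
      forall i, 0 < i < size p -> nD (take i p) < nU (take i p)].

Lemma nU_take_cat i s t :
  nU (take i (s ++ t)) = nU (take i s) + nU (take (i - size s) t).
Proof.
rewrite take_cat; case: ltnP => h; last by rewrite (@take_oversize _ i s) // nU_cat.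
by rewrite (_ : i - size s = 0) ?take0 ?addn0 //; lia.
Qed.

Lemma nD_take_cat i s t :
  nD (take i (s ++ t)) = nD (take i s) + nD (take (i - size s) t).
Proof.
rewrite take_cat; case: ltnP => h; last by rewrite (@take_oversize _ i s) // nD_cat.
by rewrite (_ : i - size s = 0) ?take0 ?addn0 //; lia.
Qed.

Lemma take_nseq_min i k (b : bool) : take i (nseq k b) = nseq (minn i k) b.
Proof. by elim: i k => [|i IH] [|k] //=; rewrite IH minnSS. Qed.

Lemma nU_take_block i x y r : nU (take i (nseq x U ++ nseq y D ++ r)) =
  minn i x + nU (take (i - (x + y)) r).
Proof.
rewrite !nU_take_cat !take_nseq_min !nU_nseq !size_nseq subnDA /U /D /=; lia.
Qed.

Lemma nD_take_block i x y r : nD (take i (nseq x U ++ nseq y D ++ r)) =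
  minn (i - x) y + nD (take (i - (x + y)) r).
Proof.
rewrite !nD_take_cat !take_nseq_min !nD_nseq !size_nseq subnDA /U /D /=; lia.
Qed.

Lemma size_runs a d : size a = size d -> size (runs a d) = sumn a + sumn d.
Proof. by move=> sz; rewrite size_nUD nU_runs // nD_runs. Qed.

(** The height is smallest at the ends of descents, so strict positivity has to be tested only at
    the inner valleys. The offsets [c1] and [c2] count the up and down steps of the blocks already
    removed by the induction. *)
Lemma runs_above c1 c2 a d :
    size a = size d -> pos a -> pos d -> c2 <= c1 ->
    c1 + sumn a = c2 + sumn d ->
  (forall i, 0 < i < size (runs a d) ->
     c2 + nD (take i (runs a d)) < c1 + nU (take i (runs a d))) <->
  (forall j, j.+1 < size a ->
     nth 0 (psums_aux c2 d) j < nth 0 (psums_aux c1 a) j).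
Proof.
elim: a d c1 c2 => [|x a IH] [|y d] c1 c2 // sz.
  by move=> *; split=> // _ i; rewrite /runs /=; lia.
case: sz => sz /andP[x0 pa] /andP[y0 pd].
move=> le12 /= tot; have szR := size_runs sz.
have a0 : 0 < size a -> 0 < sumn a by case: a pa {IH sz szR tot} => //= z a; lia.
rewrite runs_cons; split=> H.
  have H0 : 0 < size a -> c2 + y < c1 + x.
    move=> sa; have := H (x + y); rewrite nU_take_block nD_take_block.
    rewrite subnn take0 !size_cat !size_nseq szR; have := a0 sa.
    by rewrite [nU _]/= [nD _]/=; lia.
  case=> [|j] /= hj; first by apply: H0; lia.
  have {IH}[] := IH d (c1 + x) (c2 + y) sz pa pd _ _; rewrite -?addnA //.
    by have := H0 _; lia.
  move=> IH _; apply: IH => // i /andP[i0 hi].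
  have := H (i + (x + y)); rewrite nU_take_block nD_take_block addnK.
  by rewrite !size_cat !size_nseq; lia.
move=> i /andP[i0 hi]; rewrite nU_take_block nD_take_block.
have [lei|gti] := leqP i (x + y).
  rewrite (_ : i - (x + y) = 0) ?take0 ?addn0; last by lia.
  have [sa|sa] := posnP (size a).
    have sR : sumn a = 0 by case: a sa {IH sz pa szR tot a0 H hi}.
    have sR' : sumn d = 0.
      by case: d sz {IH pd szR tot H hi}; rewrite ?sa.
    by move: hi; rewrite !size_cat !size_nseq szR; lia.
  by have := H 0; rewrite /=; lia.
have sa : 0 < size a.
  move: hi; rewrite !size_cat !size_nseq; case: a sz {IH pa szR tot a0 H} => //=; case: d {pd} => // _.
  by rewrite /runs /=; lia.
have {IH}[] := IH d (c1 + x) (c2 + y) sz pa pd _ _; rewrite -?addnA //.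
  by have := H 0; rewrite /=; lia.
move=> _ IH; have {}IH := IH (fun j hj => H j.+1 hj).
have := IH (i - (x + y)); move: hi; rewrite !size_cat !size_nseq; lia.
Qed.

(** These pairs are exactly the codes of prime paths of semilength [m], by [vcode_prime],
    [codes_path] and [prime_code]. Appending [m] restores the last partial sum and keeps all entries
    strictly between 0 and [m]. *)
Definition vcode m (A B : seq nat) : Prop :=
  [/\ size A = size B, path ltn 0 (rcons A m), path ltn 0 (rcons B m) &
      forall i, i < size A -> nth 0 B i < nth 0 A i].

Lemma vcode_gt0 m A B : vcode m A B -> 0 < m.
Proof.
case=> _ pA _ _; move: pA; rewrite -cats1 cat_path /= => /and3P[_ h _].
exact: leq_trans h.
Qed.

Lemma psums_diffs A m : path ltn 0 (rcons A m) -> psums (diffs_aux 0 (rcons A m)) = rcons A m.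
Proof. exact: diffs_auxK. Qed.

Lemma vcode_prime m A B : vcode m A B -> prime_dyck m (path_of_code m A B).
Proof.
move=> vAB; have m0 := vcode_gt0 vAB; case: vAB => sz pA pB gt.
have sz' : size (diffs_aux 0 (rcons A m)) = size (diffs_aux 0 (rcons B m)).
  by rewrite !size_diffs_aux !size_rcons sz.
have := sumn_diffs pA; have := sumn_diffs pB; rewrite !add0n !last_rcons => sB sA.
rewrite /path_of_code -/(runs _ _).
split=> //; first by rewrite size_runs // sA sB addnn.
  by rewrite nU_runs // nD_runs // sA sB.
have [] := @runs_above 0 0 _ _ sz' (pos_diffs pA) (pos_diffs pB) (leqnn _) _.
  by rewrite !add0n sA sB.
move=> _ H i hi; move: H; apply=> // j.
rewrite size_diffs_aux size_rcons !diffs_auxK // ltnS => hj.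
by rewrite !nth_rcons -sz hj gt.
Qed.

Lemma codes_runs a d : size a = size d -> pos a -> pos d -> a != [::] ->
  rcons (codeA (runs a d)) (sumn a) = psums a /\
  rcons (codeD (runs a d)) (sumn d) = psums d.
Proof.
move=> sz pa pd a0; have d0 : d != [::] by case: d sz {pd}; case: a a0 {pa}.
by rewrite /codeA /codeD ascents_runs // descents_runs // !rcons_psums.
Qed.

Lemma codes_path m A B : vcode m A B ->
  codeA (path_of_code m A B) = A /\ codeD (path_of_code m A B) = B.
Proof.
case=> sz pA pB gt.
have sz' : size (diffs_aux 0 (rcons A m)) = size (diffs_aux 0 (rcons B m)).
  by rewrite !size_diffs_aux !size_rcons sz.
have n0 : diffs_aux 0 (rcons A m) != [::].
  by rewrite -size_eq0 size_diffs_aux size_rcons.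
have [] := codes_runs sz' (pos_diffs pA) (pos_diffs pB) n0.
rewrite !psums_diffs // => /eqP; rewrite eqseq_rcons => /andP[/eqP-> _].
by move=> /eqP; rewrite eqseq_rcons => /andP[/eqP-> _].
Qed.

Lemma prime_runs m p : prime_dyck m p ->
  exists a d, [/\ p = runs a d, size a = size d, pos a, pos d & a != [::]].
Proof.
case=> szp bal m0 H.
have lastp : last D p = D.
  case/lastP: p szp bal H => // p [] szp bal H; last by rewrite last_rcons.
  have := H (size p); rewrite size_rcons -cats1 take_size_cat //.
  move: bal; rewrite -cats1 nU_cat nD_cat /=; move: szp; rewrite size_rcons.
  by rewrite !/(nU _) !/(nD _) /=; lia.
have [y [a [d [Ep sz pa pd]]]] := runs_exists lastp.
have y0 : y = 0.
  case: y Ep => // y Ep; have := H 1; rewrite szp Ep /= take0.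
  by rewrite /(nU _) /(nD _) /=; lia.
exists a, d; split=> //; first by rewrite Ep y0.
apply/eqP => a0; move: sz szp; rewrite Ep y0 a0; case: (d) => // _.
by rewrite /runs /=; lia.
Qed.

Lemma prime_code m p : prime_dyck m p ->
  vcode m (codeA p) (codeD p) /\ p = path_of_code m (codeA p) (codeD p).
Proof.
move=> pr; have [a [d [Ep sz pa pd a0]]] := prime_runs pr.
have [szp bal m0 H] := pr.
have sa : sumn a = m by move: bal szp; rewrite Ep size_runs // nU_runs // nD_runs //; lia.
have sd : sumn d = m by move: bal; rewrite Ep nU_runs // nD_runs //; lia.
have [] := codes_runs sz pa pd a0; rewrite -Ep sa sd => EA ED.
split; last by rewrite /path_of_code EA ED !psums_auxK Ep.
have szA : (size (codeA p)).+1 = size a by rewrite -(size_psums_aux 0 a) -/(psums a) -EA size_rcons.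
have szD : (size (codeD p)).+1 = size d by rewrite -(size_psums_aux 0 d) -/(psums d) -ED size_rcons.
split; rewrite ?EA ?ED ?path_psums //; first by lia.
have [] := @runs_above 0 0 _ _ sz pa pd (leqnn _) _; first by rewrite sa sd.
rewrite -Ep => K _ i hi; have := K H i; rewrite -szA ltnS => /(_ hi).
rewrite -/(psums _) -/(psums _) -EA -ED !nth_rcons hi.
by rewrite (_ : size (codeD p) = size (codeA p)) ?hi //; lia.
Qed.

(** * Irreducible components *)

Lemma take_step i (p : seq bool) : i < size p ->
  (nU (take i.+1 p) = nU (take i p) + nth U p i) *
  (nD (take i.+1 p) = nD (take i p) + ~~ nth U p i).
Proof.
by move=> hi; rewrite (take_nth U hi) -cats1 nU_cat nD_cat /nU /nD /= !addn0.
Qed.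

(** An up step ending on the axis would start below it, so balance alone detects a return. *)
Lemma is_returnE m p i : dyck m p -> i < size p ->
  is_return p i = (nU (take i.+1 p) == nD (take i.+1 p)).
Proof.
case=> _ _ H hi; rewrite /is_return hi /=; have := H i.
by rewrite !(take_step hi) /D; case: (nth U p i) => /=; lia.
Qed.

Lemma prime_dyckP m p : dyck m p /\ irreducible p <-> prime_dyck m p.
Proof.
have key : dyck m p -> 0 < size p -> irreducible p <->
    forall i, 0 < i < size p -> nD (take i p) < nU (take i p).
  move=> dp p0; have [_ bal H] := dp; rewrite /irreducible /nreturns.
  (* The last step of a nonempty Dyck path is always a return and is split off the count;
     irreducibility says that no earlier step is one. *)
  case E : (size p) p0 => [|N] // _; rewrite -[N.+1]addn1 iotaD count_cat /=.
  rewrite (is_returnE dp) ?E // take_oversize ?E // bal eqxx addn0.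
  rewrite -[X in _ == X]add0n eqn_add2r -leqn0 leqNgt -has_count.
  split=> [/hasPn nr [|i] // hi|nr].
    have := nr i; rewrite mem_iota (is_returnE dp) ?E; last by lia.
    by have := H i.+1; lia.
  apply/hasPn => i; rewrite mem_iota => hi; rewrite (is_returnE dp) ?E; last by lia.
  by have := nr i.+1; lia.
split=> [[dp ir]|[sz bal m0 H]].
  have p0 : 0 < size p by case: (p) ir.
  have [szp bal _] := dp; split=> //; first by lia.
  by apply/key.
have dp : dyck m p.
  split=> // i; case: (posnP i) => [->|i0]; first by rewrite take0.
  by have [hi|hi] := ltnP i (size p); [apply/ltnW/H; lia | rewrite take_oversize ?bal].
by split=> //; apply/key => //; lia.
Qed.

Definition is_prime_path p := prime_dyck (size p)./2 p.

Lemma prime_is_prime m p : prime_dyck m p -> is_prime_path p.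
Proof. by rewrite /is_prime_path => pr; have [-> _ _ _] := pr; rewrite doubleK. Qed.

Lemma is_prime_eq m p : prime_dyck m p -> (size p)./2 = m.
Proof. by case=> -> _ _ _; rewrite doubleK. Qed.

Lemma dyck_prime m p : prime_dyck m p -> dyck m p.
Proof. by case/prime_dyckP. Qed.

Lemma dyck_catr k n p q : dyck k p -> dyck n (p ++ q) -> k <= n /\ dyck (n - k) q.
Proof.
move=> [sp bp Hp] []; rewrite size_cat nU_cat nD_cat => spq bpq H.
split; first by lia.
split=> [||i]; [by lia | by lia |].
by have := H (size p + i); rewrite !takeD !take_size_cat ?drop_size_cat // nU_cat nD_cat; lia.
Qed.

Lemma nU_cons b p : nU (b :: p) = b + nU p. Proof. by []. Qed.

Lemma nD_cons b p : nD (b :: p) = ~~ b + nD p. Proof. by []. Qed.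

(** Invariant of the scan: [h] is the current height and [s] the rest of the current component,
    which meets the axis only at its end. *)
Lemma decomp_aux_prime h (cur s t : seq bool) : s != [::] -> h + nU s = nD s ->
  (forall i, 0 < i < size s -> nD (take i s) < h + nU (take i s)) ->
  decomp_aux h cur (s ++ t) = (cur ++ s) :: decomp_aux 0 [::] t.
Proof.
elim: s h cur => [|b s IH] h cur // _; rewrite nU_cons nD_cons => tot H.
have H' i : 0 < i < size s -> ~~ b + nD (take i s) < h + (b + nU (take i s)).
  by move=> hi; have := H i.+1; rewrite /=; lia.
have H1 : s != [::] -> ~~ b < h + b.
  by case: s H {tot H' IH} => // c s /(_ 1); rewrite /=; lia.
have s0 : s = [::] -> h + b = ~~ b by move=> E; move: tot; rewrite E /=; lia.
case: b tot H1 H' s0 {H} => /= tot H1 H' s0.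
  have sn : s != [::] by apply/eqP => /s0; lia.
  by rewrite IH ?cat_rcons //; [lia | move=> i hi; have := H' i hi; lia].
have [h1|h1] := eqVneq h 1.
  by case: s tot H1 {IH H' s0} => [|c s] _ /=; [rewrite cats1 | lia].
have sn : s != [::] by apply/eqP => /s0; lia.
have := H1 sn => h2.
by rewrite IH ?cat_rcons //; [lia | move=> i hi; have := H' i hi; lia].
Qed.

Lemma decomp_prime_cat m s t : prime_dyck m s -> decomp (s ++ t) = s :: decomp t.
Proof.
case=> sz bal m0 H; rewrite /decomp decomp_aux_prime //.
by apply/eqP => s0; rewrite s0 in sz; move: sz => /=; lia.
Qed.

Lemma decomp_flatten l : (forall s, s \in l -> is_prime_path s) -> decomp (flatten l) = l.
Proof.
elim: l => //= s l IH H; rewrite (decomp_prime_cat _ (H s (mem_head _ _))) IH //.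
by move=> t tl; apply: H; rewrite inE tl orbT.
Qed.

(** Cut at the shortest nonempty balanced prefix, which is prime by minimality, and recurse on the
    rest. *)
Lemma dyck_flatten n p : dyck n p ->
  exists2 l, p = flatten l & forall s, s \in l -> is_prime_path s.
Proof.
elim/ltn_ind: n p => n IH p dp; have [sz bal H] := dp.
have [n0|n0] := posnP n.
  by exists [::] => //; apply: size0nil; rewrite sz n0.
have ex : exists i, (0 < i) && (nU (take i p) == nD (take i p)).
  by exists (size p); rewrite take_size bal eqxx sz double_gt0 n0.
case: (ex_minnP ex) => i /andP[i0 /eqP bi] mini.
have ip : i <= size p by apply: mini; rewrite take_size bal eqxx sz double_gt0 n0.
have pr : prime_dyck (nU (take i p)) (take i p).
  have si : size (take i p) = i by rewrite size_takel.
  split=> //; first by rewrite size_nUD -bi addnn.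
    by have := size_nUD (take i p); rewrite si bi; lia.
  move=> j; rewrite si => /andP[j0 ji]; rewrite take_takel; last by lia.
  by have := H j; have := mini j; lia.
have [ki dr] := dyck_catr (dyck_prime pr) (eq_ind_r (dyck n) dp (cat_take_drop i p)).
have [|l El Hl] := IH _ _ _ dr.
  by case: pr => _ _ ? _; lia.
exists (take i p :: l); first by rewrite /= -El cat_take_drop.
by move=> s; rewrite inE => /predU1P[->|/Hl//]; apply: prime_is_prime pr.
Qed.

Lemma dyck_decomp n p : dyck n p ->
  flatten (decomp p) = p /\ forall s, s \in decomp p -> is_prime_path s.
Proof. by case/dyck_flatten=> l -> H; rewrite decomp_flatten. Qed.

(** * The order on codes *)

(** Turns comparisons of indices, in which the order on codes is expressed, into counting, to which
    the complement formulas apply. *)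
Lemma index_sorted (s : seq nat) (x : nat) : sorted ltn s -> x \in s -> index x s = count (gtn x) s.
Proof.
elim: s => //= y s IH ps; rewrite inE; have [<-|yx] /= := eqVneq y x.
  move: ps; rewrite (path_sortedE ltn_trans) => /andP[/allP gt _] _.
  rewrite ltnn add0n; apply/esym/eqP; rewrite -leqn0 leqNgt -has_count.
  by apply/hasPn => z /gt h; rewrite /= -leqNgt ltnW.
move=> xs; rewrite IH ?(path_sorted ps) //.
move: ps; rewrite (path_sortedE ltn_trans) => /andP[/allP gt _].
by rewrite (gt _ xs) add1n.
Qed.

Lemma leq_index (s : seq nat) (x y : nat) : sorted ltn s -> x \in s -> y \in s ->
  x <= y -> index x s <= index y s.
Proof.
move=> ss xs ys xy; rewrite !index_sorted //; apply: sub_count => z /= zx.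
exact: leq_trans xy.
Qed.

Lemma ltn_index (s : seq nat) (x y : nat) : sorted ltn s -> x \in s -> y \in s ->
  x < y -> index x s < index y s.
Proof.
move=> ss xs ys xy; rewrite ltn_neqAle leq_index ?andbT // ?(ltnW xy) //.
by apply/eqP => /(congr1 (nth 0 s)); rewrite !nth_index //; lia.
Qed.

Lemma sorted_uniq_ltn s : sorted ltn s -> uniq s.
Proof. exact: sorted_uniq ltn_trans ltnn _. Qed.

Lemma leq_nth s i j : sorted ltn s -> i <= j -> j < size s -> nth 0 s i <= nth 0 s j.
Proof.
rewrite leq_eqVlt => ss /predU1P[->//|ij] js; apply: ltnW.
by apply: (sorted_ltn_nth ltn_trans) => //; rewrite inE; apply: leq_trans js; rewrite ltnS ltnW.
Qed.

Lemma path_rcons_sorted m s : path ltn 0 (rcons s m) -> sorted ltn s.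
Proof. by rewrite rcons_path => /andP[/path_sorted]. Qed.

Lemma vcode_sorted m A B : vcode m A B -> sorted ltn A /\ sorted ltn B.
Proof. by case=> _ pA pB _; split; apply: path_rcons_sorted (_ : path _ _ (rcons _ m)). Qed.

Definition del (s : seq nat) i := take i s ++ drop i.+1 s.

Lemma nth_del s i r : i < size s -> nth 0 (del s i) r = nth 0 s (bump i r).
Proof.
move=> hi; rewrite /del nth_cat size_takel ?(ltnW hi) // /bump.
case: ltnP => h; first by rewrite nth_take // leqNgt h.
by rewrite nth_drop; congr nth; lia.
Qed.

Lemma size_del s i : i < size s -> size (del s i) = (size s).-1.
Proof. by move=> hi; rewrite size_cat size_takel ?size_drop ?(ltnW hi) //; lia. Qed.

Lemma del_subseq s i : subseq (del s i) s.
Proof.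
rewrite -[X in subseq _ X](cat_take_drop i) cat_subseq //.
by rewrite -add1n -drop_drop drop_subseq.
Qed.

Lemma index_del (s : seq nat) (i x : nat) : uniq s -> i < size s -> x \in s -> index x s != i ->
  (x \in del s i) /\ index x (del s i) = unbump i (index x s).
Proof.
move=> us hi xs xi; have ux : index x s < size s by rewrite index_mem.
have hu : unbump i (index x s) < size (del s i).
  by rewrite size_del // /unbump; case: (ltngtP i (index x s)) xi => /=; lia.
have Ex : nth 0 (del s i) (unbump i (index x s)) = x.
  by rewrite nth_del // unbumpK ?nth_index // inE.
split; first by rewrite -[x in x \in _]Ex mem_nth.
by rewrite -[in LHS]Ex index_uniq // (subseq_uniq (del_subseq _ _)).
Qed.

(** Componentwise I <= J for the deleted index sets, expressed through the
    surviving entries: the r-th one sits no later in B than in A. *)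
Definition code_le (A B A' B' : seq nat) : Prop :=
  [/\ {subset A' <= A}, {subset B' <= B} &
      forall r, r < size A' -> index (nth 0 B' r) B <= index (nth 0 A' r) A].

Lemma code_le_refl (A B : seq nat) : size A = size B -> uniq A -> uniq B -> code_le A B A B.
Proof. by move=> sz uA uB; split=> // r hr; rewrite !index_uniq // -sz. Qed.

(** Let u be the index in [A1] of the r-th entry of [A2]. The r-th entry of [B2] has index at most u
    in [B1], so it is at most the u-th entry of [B1], to which the first relation applies. *)
Lemma code_le_trans (A B A1 B1 A2 B2 : seq nat) :
    size A1 = size B1 -> size A2 = size B2 -> sorted ltn B -> sorted ltn B1 ->
  code_le A B A1 B1 -> code_le A1 B1 A2 B2 -> code_le A B A2 B2.
Proof.
move=> sz1 sz2 sB sB1 [sA1 sB1' H1] [sA2 sB2 H2]; split=> [x /sA2/sA1|x /sB2/sB1'|] // r hr.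
have A2r : nth 0 A2 r \in A1 by apply/sA2/mem_nth.
have B2r : nth 0 B2 r \in B1 by apply/sB2/mem_nth; rewrite -sz2.
have hu : index (nth 0 A2 r) A1 < size A1 by rewrite index_mem.
have := H1 _ hu; rewrite nth_index //; apply: leq_trans.
apply: leq_index => //; first exact: sB1'.
  by apply/sB1'/mem_nth; rewrite -sz1.
by rewrite -[X in X <= _](nth_index 0 B2r); apply: leq_nth; rewrite -?sz1 // H2.
Qed.

Lemma code_le_del (A B : seq nat) i j : size A = size B -> uniq A -> uniq B ->
  i <= j -> j < size A -> code_le A B (del A i) (del B j).
Proof.
move=> sz uA uB ij jA; have iA := leq_ltn_trans ij jA.
split=> [||r]; try exact/mem_subseq/del_subseq.
rewrite size_del // => hr; rewrite !nth_del -?sz //.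
have hi : bump i r < size A by rewrite /bump; lia.
have hj : bump j r < size B by rewrite /bump; lia.
by rewrite !index_uniq // /bump; lia.
Qed.

(** As [i <= j], [bump j r <= bump i r]: each surviving entry of [B] meets an entry of [A] of the
    same or a later index. *)
Lemma vcode_del m A B i j : vcode m A B -> i <= j -> j < size A ->
  vcode m (del A i) (del B j).
Proof.
move=> vAB ij jA; have iA := leq_ltn_trans ij jA.
have [sA sB] := vcode_sorted vAB; case: vAB => sz pA pB gt.
split; rewrite ?size_del // -?sz //.
- by apply: (subseq_path ltn_trans) pA; rewrite -!cats1 cat_subseq ?del_subseq.
- by apply: (subseq_path ltn_trans) pB; rewrite -!cats1 cat_subseq ?del_subseq.
move=> r hr; rewrite !nth_del -?sz //.
apply: leq_ltn_trans (gt _ _); last by rewrite /bump; lia.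
by apply: leq_nth; rewrite -?sz /bump //; lia.
Qed.

(** All entries of [s] up to index [i] lie in [t], so the one at [i] has equally many smaller
    entries in both lists, hence the same index. *)
Lemma sorted_subset_prefix (s t : seq nat) i : sorted ltn s -> sorted ltn t -> {subset t <= s} ->
  i < find (fun x => x \notin t) s -> i < size t /\ nth 0 t i = nth 0 s i.
Proof.
move=> ss st sub hi.
have his : i < size s by apply: leq_trans hi (find_size _ _).
have memt k : k < find (fun x => x \notin t) s -> nth 0 s k \in t.
  by move=> hk; have := before_find 0 hk => /negbFE.
have Ei : index (nth 0 s i) t = i.
  rewrite index_sorted ?memt // -[RHS](index_uniq 0 his) ?sorted_uniq_ltn //.
  rewrite index_sorted ?mem_nth // -!size_filter.
  apply/perm_size/uniq_perm; rewrite ?filter_uniq ?sorted_uniq_ltn // => x.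
  rewrite !mem_filter /=; case: ltnP => //= lt; apply/idP/idP => [/sub//|xs].
  rewrite -(nth_index 0 xs) memt //; apply: ltn_trans hi.
  by have := ltn_index ss xs (mem_nth 0 his) lt; rewrite index_uniq ?sorted_uniq_ltn.
have := memt i hi; rewrite -index_mem Ei; split=> //.
by rewrite -[in LHS]Ei nth_index ?memt.
Qed.

Lemma index_subset_ltn (s t : seq nat) (a x : nat) : sorted ltn s -> sorted ltn t -> {subset t <= s} ->
  a \in s -> a \notin t -> x \in t -> a < x -> index x t < index x s.
Proof.
move=> ss st sub as_ at_ xt ax; rewrite !index_sorted ?sub // -!size_filter.
have := @uniq_leq_size _ (a :: filter (gtn x) t) (filter (gtn x) s); apply.
  by rewrite /= mem_filter (negPf at_) andbF filter_uniq ?sorted_uniq_ltn.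
move=> y; rewrite inE !mem_filter => /predU1P[->|/andP[-> /sub]//].
by rewrite as_ andbT.
Qed.

Lemma leq_unbump i j u v : i <= j -> v <= u -> (i < u -> v <= j -> v < u) ->
  unbump j v <= unbump i u.
Proof. by rewrite /unbump; lia. Qed.

(** The entries to delete are the first of [A] missing from [A'] and the first of [B] missing from
    [B']. The index condition could break only where the index in [A] drops and the one in [B] does
    not; strict inequality holds there. *)
Lemma code_le_step (A B A' B' : seq nat) : 
    size A = size B -> size A' = size B' -> size A' < size A ->
    sorted ltn A -> sorted ltn B -> sorted ltn A' -> sorted ltn B' ->
    code_le A B A' B' ->
  exists i j, [/\ i <= j, j < size A & code_le (del A i) (del B j) A' B'].
Proof.
move=> sz sz' lt sA sB sA' sB' [subA subB H].
have hasN (s t : seq nat) : sorted ltn s -> size t < size s -> has (fun x => x \notin t) s.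
  move=> ss lts; apply/negPn/negP => /hasPn h.
  have := uniq_leq_size (sorted_uniq_ltn ss) (_ : {subset s <= t}); rewrite leqNgt lts.
  by move=> h'; have : false by apply: h' => x /h /negPn.
have hA := hasN _ _ sA lt; have hB : has (fun x => x \notin B') B by apply: hasN => //; lia.
set i := find (fun x => x \notin A') A; set j := find (fun x => x \notin B') B.
have iA : i < size A by rewrite -has_find.
have jB : j < size B by rewrite -has_find.
have nA : nth 0 A i \notin A' := nth_find 0 hA.
have nB : nth 0 B j \notin B' := nth_find 0 hB.
have preA k : k < i -> k < size A' /\ nth 0 A' k = nth 0 A k by apply: sorted_subset_prefix.
have preB k : k < j -> k < size B' /\ nth 0 B' k = nth 0 B k by apply: sorted_subset_prefix.
have [uA uB] := (sorted_uniq_ltn sA, sorted_uniq_ltn sB).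
have [uA' uB'] := (sorted_uniq_ltn sA', sorted_uniq_ltn sB').
(* If [j < i], then [A'] and [A] agree at [j], so the [j]-th entry of [B'] has index at most [j] in
   [B]. Index [j] belongs to a missing entry, and a smaller index would repeat an entry of [B']. *)
have ij : i <= j.
  rewrite leqNgt; apply/negP => ji; have [jA' Ej] := preA j ji.
  have Bj : nth 0 B' j \in B by apply/subB/mem_nth; rewrite -sz'.
  have := H j jA'; rewrite Ej index_uniq ?sz // leq_eqVlt => /predU1P[E|lt'].
    by case/negP: nB; rewrite -E nth_index // mem_nth // -sz'.
  have [h] := preB _ lt'; rewrite nth_index // => /eqP.
  have hj : j < size B' by rewrite -sz'.
  by rewrite (nth_uniq 0 h hj uB') => /eqP Et; rewrite Et ltnn in lt'.
exists i, j; split=> //; first by rewrite sz.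
have dA x : x \in A' -> x \in del A i /\ index x (del A i) = unbump i (index x A).
  move=> xA'; apply: index_del => //; first exact: subA.
  by apply: contraNneq nA => <-; rewrite nth_index // subA.
have dB x : x \in B' -> x \in del B j /\ index x (del B j) = unbump j (index x B).
  move=> xB'; apply: index_del => //; first exact: subB.
  by apply: contraNneq nB => <-; rewrite nth_index // subB.
split=> [x /dA[]|x /dB[]|r hr] //.
have Ar := mem_nth 0 hr; have hrB := hr; rewrite sz' in hrB; have Br := mem_nth 0 hrB.
have [_ ->] := dA _ Ar; have [_ ->] := dB _ Br; have := H r hr.
set u := index _ A; set u' := index _ B => le_u.
apply: leq_unbump => // iu; rewrite leq_eqVlt => /predU1P[Eu'|u'j].
  by case/negP: nB; rewrite -Eu' nth_index // subB.
(* Suppose [u = u']. As [B] and [B'] agree before [j], [u' = r]; but the missing entry of [A] lies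
   below the [r]-th entry of [A'], which forces [r < u]. *)
rewrite ltn_neqAle le_u andbT; apply/eqP => Eu.
have [h] := preB u' u'j; rewrite /u' nth_index ?subB // -/u' => /eqP.
rewrite nth_uniq // => /eqP Er.
have : nth 0 A i < nth 0 A' r.
  rewrite ltnNge; apply/negP => le; have := leq_index sA (subA _ Ar) (mem_nth 0 iA) le.
  by rewrite index_uniq // -/u leqNgt iu.
move/(index_subset_ltn sA sA' subA (mem_nth 0 iA) nA Ar).
by rewrite index_uniq // -/u -Eu Er ltnn.
Qed.

Lemma sorted_subset_eq (s t : seq nat) : sorted ltn s -> sorted ltn t -> {subset t <= s} ->
  size s <= size t -> s = t.
Proof.
move=> ss st sub le; apply: (irr_sorted_eq ltn_trans ltnn) => // x.
by have [_ ->] := uniq_min_size (sorted_uniq_ltn st) sub le.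
Qed.

Lemma covers_code m P Q : prime_dyck m P -> covers P Q ->
  prime_dyck m Q /\ exists i j, [/\ i <= j, j < size (codeA P),
    codeA Q = del (codeA P) i & codeD Q = del (codeD P) j].
Proof.
move=> pP [m' [dP dQ iP iQ H]]; split=> //; apply/prime_dyckP; split=> //.
by have := is_prime_eq pP; have [-> _ _] := dP; rewrite doubleK => <-.
Qed.

Lemma le_irr_code m P Q : prime_dyck m P -> le_irr P Q ->
  prime_dyck m Q /\ code_le (codeA P) (codeD P) (codeA Q) (codeD Q).
Proof.
move=> pP /clos_rt_rt1n_iff lePQ; elim: lePQ pP => {P Q} [P|P P1 Q cP _ IH] pP.
  have [vP _] := prime_code pP; have [sA sB] := vcode_sorted vP; case: vP => sz _ _ _.
  by split=> //; apply: code_le_refl => //; apply: sorted_uniq_ltn.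
have [pP1 [i [j [ij jA EA ED]]]] := covers_code pP cP.
have [pQ le1] := IH pP1; split=> //.
have [vP _] := prime_code pP; have [sA sB] := vcode_sorted vP; case: vP => sz _ _ _.
have [vP1 _] := prime_code pP1; have [_ sB1] := vcode_sorted vP1; case: vP1 => sz1 _ _ _.
have [vQ _] := prime_code pQ; case: vQ => szQ _ _ _.
apply: code_le_trans le1 => //; rewrite EA ED.
by apply: code_le_del => //; apply: sorted_uniq_ltn.
Qed.

(** Each [code_le_step] is one covering, with an intermediate path that is prime by [vcode_del]; the
    induction is on a bound for the length of the code of [P]. *)
Lemma code_le_irr m P Q : prime_dyck m P -> prime_dyck m Q ->
  code_le (codeA P) (codeD P) (codeA Q) (codeD Q) -> le_irr P Q.
Proof.
move=> + pQ; have [vQ EQ] := prime_code pQ; have [sA' sB'] := vcode_sorted vQ.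
have szQ : size (codeA Q) = size (codeD Q) by case: vQ.
move: {2}(size (codeA P)) (leqnn (size (codeA P))) => k.
have base R : prime_dyck m R -> code_le (codeA R) (codeD R) (codeA Q) (codeD Q) ->
    size (codeA R) <= size (codeA Q) -> le_irr R Q.
  move=> pR [subA subB _] leA; have [vR ER] := prime_code pR.
  have [sA sB] := vcode_sorted vR; have EA := sorted_subset_eq sA sA' subA leA.
  have szR : size (codeA R) = size (codeD R) by case: vR.
  have ED : codeD R = codeD Q by apply: sorted_subset_eq => //; rewrite -szR -szQ.
  by rewrite ER EQ EA ED; apply: rt_refl.
elim: k P => [|k IH] P hk pP le; first by apply: base (leq_trans hk _).
have [/(base _ pP le)//|lt] := leqP (size (codeA P)) (size (codeA Q)).
have [vP EP] := prime_code pP; have [sA sB] := vcode_sorted vP.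
have szP : size (codeA P) = size (codeD P) by case: vP.
have [i [j [ij jA le1]]] := code_le_step szP szQ lt sA sB sA' sB' le.
have v1 := vcode_del vP ij jA; have p1 := vcode_prime v1.
have [E1A E1D] := codes_path v1.
apply: (rt_trans _ _ _ (path_of_code m (del (codeA P) i) (del (codeD P) j))).
  apply: rt_step; exists m; have [dP iP] := (prime_dyckP _ _).2 pP.
  have [d1 i1] := (prime_dyckP _ _).2 p1; split=> //.
  by exists i, j; rewrite E1A E1D.
apply: IH; rewrite ?E1A ?E1D // size_del ?(leq_ltn_trans ij jA) //.
by case: (size _) hk jA.
Qed.

(** * The map L' on codes *)

(** The code of L', after the substitutions a = n - x and d = n - 1 - x. *)
Definition dualA m (A : seq nat) := [seq a <- iota 2 (m - 2) | m.+1 - a \notin A].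
Definition dualB m (B : seq nat) := [seq d <- iota 1 (m - 2) | m.-1 - d \notin B].

Definition cle t (s : seq nat) := count (geq t) s.

(** Beyond lying strictly between 0 and [m], each entry of [A] exceeds a positive entry of [B], and
    each entry of [B] is below an entry of [A]. *)
Lemma vcode_range m A B : vcode m A B ->
  {in A, forall a, 1 < a < m} /\ {in B, forall d, 0 < d < m.-1}.
Proof.
case=> sz pA pB gt.
have rg (s : seq nat) : path ltn 0 (rcons s m) -> {in s, forall x, 0 < x < m}.
  move=> p x xs; apply/andP; split.
    move: p; rewrite (path_sortedE ltn_trans) => /andP[/allP + _]; apply.
    by rewrite mem_rcons inE xs orbT.
  move: p; rewrite rcons_path => /andP[p lt]; apply: leq_ltn_trans lt.
  have hx : index x s < size s by rewrite index_mem.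
  rewrite -nth_last -[X in X <= _](nth_index 0 xs); apply: leq_nth; try lia.
  exact: path_sorted p.
split=> x xs.
  have := gt (index x A); rewrite index_mem nth_index // => /(_ xs).
  have : nth 0 B (index x A) \in B by rewrite mem_nth // -sz index_mem.
  by move=> /(rg _ pB); have := rg _ pA x xs; lia.
have := gt (index x B); rewrite sz index_mem nth_index // => /(_ xs).
have : nth 0 A (index x B) \in A by rewrite mem_nth // sz index_mem.
by move=> /(rg _ pA); have := rg _ pB x xs; lia.
Qed.

(** Since [f] is an involution, its image of [S] consists of the x with [f x] in [S]. Truncated
    subtraction is involutive only on a bounded range, hence the conditions local to [T] and [S]. *)
Lemma perm_compl (T S : seq nat) (f : nat -> nat) : uniq T -> uniq S ->
  {in T, involutive f} -> {in S, forall x, f x \in T} -> {in S, involutive f} ->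
  perm_eq T (map f S ++ [seq x <- T | f x \notin S]).
Proof.
move=> uT uS fT fS fK; apply: uniq_perm => //.
  rewrite cat_uniq filter_uniq // andbT map_inj_in_uniq ?uS /=; last first.
    exact: can_in_inj fK.
  apply/hasPn => x; rewrite mem_filter => /andP[nS xT]; apply/negP => /mapP[y yS Ex].
  by case/negP: nS; rewrite Ex fK.
move=> x; rewrite mem_cat mem_filter; apply/idP/orP => [xT|[/mapP[y yS ->]|/andP[]//]].
  have [fS'|] := boolP (f x \in S); last by right.
  by left; apply/mapP; exists (f x); rewrite ?fT.
exact: fS.
Qed.

Lemma count_compl (p : pred nat) (T S : seq nat) (f : nat -> nat) : uniq T -> uniq S ->
  {in T, involutive f} -> {in S, forall x, f x \in T} -> {in S, involutive f} ->
  count p T = count (preim f p) S + count p [seq x <- T | f x \notin S].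
Proof.
move=> uT uS fT fS fK; have /seq.permP/(_ p) := perm_compl uT uS fT fS fK.
by rewrite count_cat count_map.
Qed.

Lemma count_gtn_iota a b n : count (gtn a) (iota b n) = minn (a - b) n.
Proof. by elim: n b => [|n IH] b /=; rewrite ?minn0 // IH; case: ltnP; lia. Qed.

(** A number from 2 to [a - 1] either lies in the dual or is the reflection of an entry of [A] above
    [m.+1 - a]. The additive form avoids truncated subtraction. *)
Lemma count_gtn_dualA m (A : seq nat) a : uniq A -> {in A, forall a, 1 < a < m} ->
  1 < a <= m -> count (gtn a) (dualA m A) + size A = a - 2 + cle (m.+1 - a) A.
Proof.
move=> uA rg ha.
have := @count_compl (gtn a) (iota 2 (m - 2)) A (subn m.+1) (iota_uniq _ _) uA.
rewrite count_gtn_iota (_ : minn _ _ = a - 2); last by lia.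
move=> /(_ _ _ _)->; first last.
- by move=> x /rg; lia.
- by move=> x /rg; rewrite mem_iota; lia.
- by move=> x; rewrite mem_iota; lia.
rewrite -/(dualA m A).
have -> : count (preim (subn m.+1) (gtn a)) A = count (predC (geq (m.+1 - a))) A.
  by apply: eq_in_count => x /rg /=; lia.
by rewrite -(count_predC (geq (m.+1 - a)) A) /cle; lia.
Qed.

Lemma count_gtn_dualB m (B : seq nat) d : uniq B -> {in B, forall d, 0 < d < m.-1} ->
  0 < d < m -> count (gtn d) (dualB m B) + size B = d - 1 + cle (m.-1 - d) B.
Proof.
move=> uB rg hd.
have := @count_compl (gtn d) (iota 1 (m - 2)) B (subn m.-1) (iota_uniq _ _) uB.
rewrite count_gtn_iota (_ : minn _ _ = d - 1); last by lia.
move=> /(_ _ _ _)->; first last.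
- by move=> x /rg; lia.
- by move=> x /rg; rewrite mem_iota; lia.
- by move=> x; rewrite mem_iota; lia.
rewrite -/(dualB m B).
have -> : count (preim (subn m.-1) (gtn d)) B = count (predC (geq (m.-1 - d))) B.
  by apply: eq_in_count => x /rg /=; lia.
by rewrite -(count_predC (geq (m.-1 - d)) B) /cle; lia.
Qed.

Lemma mem_dualA m (A : seq nat) a :
  (a \in dualA m A) = (1 < a < m) && (m.+1 - a \notin A).
Proof. by rewrite mem_filter mem_iota andbC; congr (_ && _); lia. Qed.

Lemma mem_dualB m (B : seq nat) d :
  (d \in dualB m B) = (0 < d < m.-1) && (m.-1 - d \notin B).
Proof. by rewrite mem_filter mem_iota andbC; congr (_ && _); lia. Qed.

Lemma sorted_dualA m A : sorted ltn (dualA m A).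
Proof. by apply: sorted_filter (iota_ltn_sorted _ _); apply: ltn_trans. Qed.

Lemma sorted_dualB m B : sorted ltn (dualB m B).
Proof. by apply: sorted_filter (iota_ltn_sorted _ _); apply: ltn_trans. Qed.

Lemma cle0 t (s : seq nat) : {in s, forall x, t < x} -> cle t s = 0.
Proof.
move=> h; apply/eqP; rewrite -leqn0 leqNgt -has_count.
by apply/hasPn => x /h; rewrite /= -ltnNge.
Qed.

Lemma leq_cle_vcode t (A B : seq nat) : size A = size B ->
  (forall i, i < size A -> nth 0 B i < nth 0 A i) -> cle t.+1 A <= cle t B.
Proof.
rewrite /cle; elim: A B => [|a A IH] [|b B] //= [sz] gt; apply: leq_add.
  by have /= h := gt 0 isT; case: (leqP a t.+1) => //= ha; rewrite (_ : b <= t) //; lia.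
by apply: IH => // i hi; apply: gt i.+1 hi.
Qed.

Lemma cleD s t (A : seq nat) : uniq A -> cle (t + s) A <= cle t A + s.
Proof.
move=> uA; elim: s => [|s IH]; first by rewrite !addn0.
rewrite !addnS; apply: (@leq_trans (cle (t + s) A + 1)); last by lia.
apply: (@leq_trans (cle (t + s) A + count_mem (t + s).+1 A)).
  rewrite /cle -count_predUI; apply: leq_trans (leq_addr _ _).
  by apply: sub_count => x /=; lia.
by rewrite count_uniq_mem //; case: (_ \in _); lia.
Qed.

Lemma cleS_notin t (A : seq nat) : t.+1 \notin A -> cle t.+1 A = cle t A.
Proof.
move=> nA; apply: eq_in_count => x xA /=; have : x != t.+1 by apply: contraNneq nA => <-.
by lia.
Qed.

(** Suppose entries a and d of equal index had a <= d. As m+1-a is not in [A], [cle] of [A] at m+1-a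
    equals that at m-a, which is at most that at m-d plus d-a, hence at most [cle] of [B] at m-1-d
    plus d-a. This contradicts the two index counts. *)
Lemma vcode_dual m A B : vcode m A B -> vcode m (dualA m A) (dualB m B).
Proof.
move=> vAB; have [rA rB] := vcode_range vAB; have [sA sB] := vcode_sorted vAB.
have m0 := vcode_gt0 vAB; have [sz _ _ gt] := vAB.
have [uA uB] := (sorted_uniq_ltn sA, sorted_uniq_ltn sB).
have pth (s : seq nat) : sorted ltn s -> {in s, forall x, 0 < x < m} -> path ltn 0 (rcons s m).
  move=> ss rg; rewrite -cats1 cat_path (path_sortedE ltn_trans) ss andbT /= andbT.
  apply/andP; split; first by apply/allP => x /rg; lia.
  by have := mem_last 0 s; rewrite inE => /predU1P[->//|/rg/andP[]].
have szd : size (dualA m A) = size (dualB m B).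
  have [m1|m2] := leqP m 1.
    by rewrite /dualA /dualB (_ : m - 2 = 0) //; lia.
  (* At the top of the ranges, [m] and [m.-1], the counts cover the whole lists; both lengths are
     [m - 2] minus the length of the code. *)
  have := count_gtn_dualA uA rA (_ : 1 < m <= m); rewrite m2 leqnn => /(_ isT).
  have := count_gtn_dualB uB rB (_ : 0 < m.-1 < m).
  have -> : 0 < m.-1 < m by lia.
  move=> /(_ isT).
  have -> : count (gtn m.-1) (dualB m B) = size (dualB m B).
    by apply/eqP; rewrite -all_count; apply/allP => x; rewrite mem_dualB /=; lia.
  have -> : count (gtn m) (dualA m A) = size (dualA m A).
    by apply/eqP; rewrite -all_count; apply/allP => x; rewrite mem_dualA /=; lia.
  by rewrite !cle0 => [|x /rA|x /rB]; rewrite -?sz; lia.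
split=> //.
- by apply: pth; [exact: sorted_dualA | move=> x; rewrite mem_dualA; lia].
- by apply: pth; [exact: sorted_dualB | move=> x; rewrite mem_dualB; lia].
move=> i hi; set d := nth 0 _ i; set a := nth 0 _ i.
have ha : a \in dualA m A by rewrite mem_nth.
have hd : d \in dualB m B by rewrite mem_nth -?szd.
have := index_sorted (sorted_dualA m A) ha; have := index_sorted (sorted_dualB m B) hd.
rewrite !index_uniq -?szd ?sorted_uniq_ltn ?sorted_dualA ?sorted_dualB //.
move: ha hd; rewrite mem_dualA mem_dualB => /andP[ra na] /andP[rd _] Ed Ea.
have := count_gtn_dualA uA rA (a := a); have := count_gtn_dualB uB rB (d := d).
rewrite -Ed -Ea -sz (_ : 0 < d < m); last by lia.
rewrite (_ : 1 < a <= m); last by lia.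
move=> /(_ isT) Eqd /(_ isT) Eqa; rewrite ltnNge; apply/negP => le_ad.
have Es : m.+1 - a = (m - a).+1 by lia.
have h1 : cle (m.+1 - a) A = cle (m - a) A by rewrite Es cleS_notin // -Es.
have := @leq_cle_vcode (m.-1 - d) _ _ sz gt; rewrite (_ : _.+1 = m - d); last by lia.
have := @cleD (d - a) (m - d) _ uA; rewrite (_ : m - d + (d - a) = m - a); last by lia.
by move: Eqd Eqa h1 ra rd le_ad; clear; lia.
Qed.

(** (A, B) and (A', B') prescribe the running maxima of y and of its reverse
    complement.  The first two clauses say that no value and no position is
    prescribed twice; the last is the Hall inequality, in which the prescribed
    positions and values have been counted explicitly. *)
Definition compat m (A B A' B' : seq nat) : Prop :=
  [/\ {in A, forall a, m.+1 - a \notin A'}, {in B, forall d, m.-1 - d \notin B'} &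
      forall r, r < size A ->
        (nth 0 B r).+1 + cle (m.-1 - nth 0 B r) B' <=
        nth 0 A r + cle (m.+1 - nth 0 A r) A'].

(** Indices in the dual lists are counts of smaller entries; after inserting the counting formulas
    the common length of [A'] and [B'] cancels, and adding 2 on both sides gives the inequality of
    [compat]. *)
Lemma code_le_dual m (A B A' B' : seq nat) : vcode m A B -> vcode m A' B' ->
  code_le (dualA m A') (dualB m B') A B <-> compat m A B A' B'.
Proof.
move=> v v'; have [rA rB] := vcode_range v; have [rA' rB'] := vcode_range v'.
have [/sorted_uniq_ltn uA /sorted_uniq_ltn uB] := vcode_sorted v'.
have [sz _ _ _] := v; have [sz' _ _ _] := v'.
have idx r : r < size A ->
    {subset A <= dualA m A'} -> {subset B <= dualB m B'} ->
    (index (nth 0 B r) (dualB m B') <= index (nth 0 A r) (dualA m A')) =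
    ((nth 0 B r).+1 + cle (m.-1 - nth 0 B r) B' <=
        nth 0 A r + cle (m.+1 - nth 0 A r) A').
  move=> hr subA subB; have hrB := hr; rewrite sz in hrB.
  have Ar := mem_nth 0 hr; have Br := mem_nth 0 hrB.
  rewrite !index_sorted ?sorted_dualA ?sorted_dualB ?subA ?subB //.
  have /andP[a1 am] : 1 < nth 0 A r < m := rA _ Ar.
  have /andP[d1 dm] : 0 < nth 0 B r < m.-1 := rB _ Br.
  have := count_gtn_dualA uA rA' (a := nth 0 A r); rewrite a1 (ltnW am) => /(_ isT).
  have := count_gtn_dualB uB rB' (d := nth 0 B r).
  rewrite d1 (leq_trans dm (leq_pred _)) -sz' => /(_ isT).
  by move: a1 d1; clear=> a1 d1 E1 E2; apply/idP/idP; lia.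
split=> [[subA subB H]|[nA nB H]].
  split=> [a /subA|d /subB|r hr].
  - by rewrite mem_dualA => /andP[].
  - by rewrite mem_dualB => /andP[].
  - by rewrite -idx // H.
have subA : {subset A <= dualA m A'}.
  by move=> x xA; rewrite mem_dualA rA ?nA.
have subB : {subset B <= dualB m B'}.
  by move=> x xB; rewrite mem_dualB rB ?nB.
by split=> // r hr; rewrite idx // H.
Qed.

(** L' lists the complement downwards and then reflects it, which makes it increasing again; for
    sorted lists comparing members suffices. The local fact [refl] serves both reflections, about
    [m] and [m.-1]. *)
Lemma Lp_irrE m p : prime_dyck m p ->
  Lp_irr p = path_of_code m (dualA m (codeA p)) (dualB m (codeD p)).
Proof.
move=> pp; have [v _] := prime_code pp; have [rA rB] := vcode_range v.
have m0 := vcode_gt0 v; have refl k (P R : pred nat) a b : (forall x, a <= x < a + (m - 2) -> b <= k - x < b + (m - 2)) ->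
    (forall x, b <= x < b + (m - 2) -> a <= k - x < a + (m - 2)) ->
    (forall x, b <= x < b + (m - 2) -> P (k - x) = R x) ->
    b + (m - 2) <= k.+1 -> a + (m - 2) <= k.+1 ->
    [seq k - x | x <- rev [seq x <- iota a (m - 2) | P x]] = [seq x <- iota b (m - 2) | R x].
  move=> hab hba hP hb ha; apply: (irr_sorted_eq ltn_trans ltnn).
  - rewrite map_rev rev_sorted sorted_map.
    apply: (@sub_in_sorted _ (fun x => x <= k) ltn); last first.
    + by apply: sorted_filter (iota_ltn_sorted _ _); apply: ltn_trans.
    + by apply/allP => x; rewrite mem_filter mem_iota => /andP[_]; lia.
    + move=> x y hx hy; have {}hx : x <= k := hx; have {}hy : y <= k := hy; rewrite /relpre /=; lia.
  - by apply: sorted_filter (iota_ltn_sorted _ _); apply: ltn_trans.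
  move=> x; rewrite mem_filter mem_iota; apply/mapP/andP => [[y]|[Rx hx]].
    rewrite mem_rev mem_filter mem_iota => /andP[Py hy] ->.
    have hx := hab _ hy; split=> //.
    by rewrite -hP // (_ : k - (k - y) = y) //; lia.
  have hy := hba _ hx.
  exists (k - x); last by lia.
  by rewrite mem_rev mem_filter mem_iota hP // Rx.
rewrite /Lp_irr (is_prime_eq pp); congr path_of_code.
  apply: refl; try by move=> *; lia.
  move=> x hx; congr (~~ _); apply/mapP/idP => [[y yA Ey]|h].
    by rewrite (_ : m.+1 - x = y) //; have := rA y yA; lia.
  by exists (m.+1 - x) => //; lia.
by apply: refl; try by move=> *; lia.
Qed.

Lemma Lp_irr_prime m p : prime_dyck m p -> prime_dyck m (Lp_irr p).
Proof.
move=> pp; rewrite (Lp_irrE pp); apply/vcode_prime/vcode_dual.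
by have [] := prime_code pp.
Qed.

Lemma le_Lp_irr m P Q : prime_dyck m P -> prime_dyck m Q ->
  le_irr (Lp_irr Q) P <-> compat m (codeA P) (codeD P) (codeA Q) (codeD Q).
Proof.
move=> pP pQ; have pL := Lp_irr_prime pQ.
have [vP _] := prime_code pP; have [vQ _] := prime_code pQ.
have [EA ED] := codes_path (vcode_dual vQ).
split=> [/(le_irr_code pL)[_]|/(code_le_dual vP vQ)].
  by rewrite (Lp_irrE pQ) EA ED => /(code_le_dual vP vQ).
by move=> h; apply: (code_le_irr pL pP); rewrite (Lp_irrE pQ) EA ED.
Qed.

(** * Codes of running-maximum paths *)

Lemma nseqU_D_inj i j t t' : nseq i U ++ D :: t = nseq j U ++ D :: t' -> i = j /\ t = t'.
Proof.
elim: i j => [|i IH] [|j] //= [].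
  by move=> ->.
by move=> /IH[-> ->].
Qed.

Lemma mu_aux_D c s e r : mu_aux c s = nseq e D ++ r <->
  [/\ e <= size s, all (geq c) (take e s) & mu_aux c (drop e s) = r].
Proof.
elim: e s => [|e IH] s; first by rewrite take0 drop0; split=> [|[]].
case: s => [|x s] /=; first by split=> [|[]].
case: ltnP => cx.
  split=> [|[_ //]].
  by rewrite -[x - c]prednK ?subn_gt0.
rewrite /= ltnS.
by split=> [[/IH]|/IH ->].
Qed.

Lemma mu_aux_block c s a e r : 0 < a -> 0 < e ->
  mu_aux c s = nseq a U ++ nseq e D ++ r <->
  [/\ e <= size s, nth 0 s 0 = c + a, all (geq (c + a)) (take e s) &
      mu_aux (c + a) (drop e s) = r].
Proof.
move=> a0; case: e => // e _; case: s => [|x s].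
  by split=> [|[]//]; case: a a0.
rewrite /=; case: ltnP => cx; last first.
  by split=> [|[_ h]]; [case: a a0 | lia].
split=> [/nseqU_D_inj[xc /mu_aux_D]|[he Ex /andP[_ h] Er]].
  by rewrite -xc subnKC ?(ltnW cx) // leqnn => -[].
rewrite Ex addKn; congr (_ ++ _ :: _); apply/mu_aux_D; split=> //.
Qed.

(** At position [b] the running maximum so far is [c]. A block of [a - c] up and [d - b] down steps
    means that the letter at [b] is the new maximum [a] and is not exceeded before position [d]. *)
Lemma mu_aux_runs c b A B (y : seq nat) : path ltn c A -> path ltn b B ->
    size A = size B -> b <= size y ->
  mu_aux c (drop b y) = runs (diffs_aux c A) (diffs_aux b B) <->
  [/\ size y = last b B,
      forall i, i < size A -> nth 0 y (nth 0 (b :: B) i) = nth 0 A i &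
      forall i p, i < size A -> b <= p < nth 0 B i -> nth 0 y p <= nth 0 A i].
Proof.
elim: A B c b => [|a A IH] [|d B] c b // pA pB sz by_.
  rewrite /runs /=; split=> [|[Ey _ _]]; last by rewrite -Ey drop_size.
  have := leqP (size y) b; case=> [yb _|lt].
    by split=> //; apply/eqP; rewrite eqn_leq yb.
  by rewrite (drop_nth 0 lt) /=; case: ifP => // _; case: (_ - _).
case/andP: pA => ca pA; case/andP: pB => bd pB; case: sz => sz.
rewrite [diffs_aux c _]/= [diffs_aux b _]/= runs_cons.
have le_lastB : d <= last d B.
  have := mem_last d B; rewrite inE => /predU1P[->//|h].
  by have /allP/(_ _ h) := order_path_min ltn_trans pB; apply: ltnW.
have hda : 0 < a - c by rewrite subn_gt0.
have hbd : 0 < d - b by rewrite subn_gt0.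
apply: (iff_trans (mu_aux_block _ _ _ hda hbd)).
rewrite size_drop drop_drop subnK ?(ltnW bd) // subnKC ?(ltnW ca) // nth_drop addn0.
have blk : d <= size y -> all (geq a) (take (d - b) (drop b y)) <->
    forall p, b <= p < d -> nth 0 y p <= a.
  move=> dy; split=> [/(all_nthP 0) h p hp|h].
    have := h (p - b); rewrite size_takel ?size_drop; last by lia.
    rewrite nth_take; last by lia.
    by rewrite nth_drop subnKC; [apply; lia | lia].
  apply/(all_nthP 0) => i; rewrite size_takel ?size_drop; last by lia.
  by move=> hi; rewrite nth_take // nth_drop; apply: h; lia.
have minA : forall i, i < size A -> a <= nth 0 A i.
  move=> i hi; apply: ltnW; have := order_path_min ltn_trans pA.
  by move/all_nthP; apply.
split=> [[h Ey Ha HF]|[Ey Hp Hle]].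
  have dy : d <= size y by lia.
  have [E1 E2 E3] := (IH B a d pA pB sz dy).1 HF.
  split=> //; first by case.
  case=> [|i] p hi hp; first by apply: (blk dy).1.
  (* Letters of the first block are at most [a], which is below all later maxima. *)
  have [pd|dp] := ltnP p d; last by apply: E3 => //; rewrite dp; case/andP: hp.
  by apply: leq_trans (minA i hi); apply: ((blk dy).1 Ha); rewrite pd andbT; case/andP: hp.
have dy : d <= size y by rewrite Ey.
split; first by lia.
- exact: Hp 0 isT.
- by apply/blk => // p hp; apply: Hle 0 _ isT hp.
apply/IH => //; split=> // [i hi|i p hi hp]; first exact: Hp i.+1 hi.
by apply: Hle i.+1 _ hi _; rewrite /=; lia.
Qed.

(** * From words to inequalities *)

(** The reverse complement. If [y] is the complement of a permutation word, [rc y] is that word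
    reversed, the one that [mu] scans. *)
Definition rc (y : seq nat) := rev (map (subn (size y).+1) y).

Lemma nth_rc y p : p < size y -> nth 0 (rc y) p = (size y).+1 - nth 0 y ((size y).-1 - p).
Proof.
move=> hp; rewrite nth_rev ?size_map // (nth_map 0); last by lia.
by congr (_ - nth _ _ _); lia.
Qed.

Section Word.

Variables (m : nat) (y : seq nat).
Hypothesis py : perm_eq y (iota 1 m).

Lemma size_word : size y = m.
Proof. by rewrite (perm_size py) size_iota. Qed.

Lemma uniq_word : uniq y.
Proof. by rewrite (perm_uniq py) iota_uniq. Qed.

Lemma mem_word v : (v \in y) = (0 < v <= m).
Proof. by rewrite (perm_mem py) mem_iota. Qed.

Lemma nth_word p : p < m -> 0 < nth 0 y p <= m.
Proof. by move=> hp; rewrite -mem_word mem_nth ?size_word. Qed.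

Lemma perm_rc : perm_eq (rc y) (iota 1 m).
Proof.
have im : map (subn m.+1) (iota 1 m) = rev (iota 1 m).
  apply: (@eq_from_nth _ 0); rewrite size_map ?size_rev // size_iota => i hi.
  rewrite (nth_map 0) ?size_iota // nth_rev ?size_iota // !nth_iota; lia.
by rewrite /rc perm_rev size_word (permPl (perm_map _ py)) im perm_rev.
Qed.

Lemma rcK : rc (rc y) = y.
Proof.
rewrite /rc size_rev size_map map_rev revK -map_comp -[RHS]map_id.
by apply/eq_in_map => x; rewrite mem_word size_word /=; lia.
Qed.

(** A code of length k describes k+1 records: the first stands at position 0 and the last has value
    [m], hence [0 :: B] and [rcons A m]. The bound for the last block is automatic, as no letter
    exceeds [m]. *)
Lemma mu_code A B : vcode m A B ->
  mu_aux 0 y = path_of_code m A B <->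
  (forall i, i <= size A -> nth 0 y (nth 0 (0 :: B) i) = nth 0 (rcons A m) i) /\
  (forall i p, i < size A -> p < nth 0 B i -> nth 0 y p <= nth 0 A i).
Proof.
move=> v; have [sz pA pB _] := v.
have := @mu_aux_runs 0 0 (rcons A m) (rcons B m) y pA pB; rewrite drop0.
rewrite !size_rcons sz last_rcons size_word => /(_ erefl isT) H.
apply: iff_trans H _; have n0 i : i <= size B -> nth 0 (0 :: rcons B m) i = nth 0 (0 :: B) i.
  by case: i => //= i hi; rewrite nth_rcons hi.
split=> [[_ h1 h2]|[h1 h2]].
  split=> [i hi|i p hi hp].
    by rewrite -h1 ?n0.
  have := h2 i p; rewrite !nth_rcons sz hi; apply=> //; exact: ltnW.
split=> // i.
  by rewrite ltnS => hi; rewrite n0 // h1.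
move=> p; rewrite ltnS leq_eqVlt => /predU1P[->|hi]; rewrite !nth_rcons sz.
  by rewrite ltnn eqxx => /andP[_ /nth_word/andP[]].
by rewrite hi => /andP[_]; apply: h2.
Qed.

End Word.

(** Separates the two prescriptions: a record of [y] at position p has value at least p+2, while a
    record of [rc y], read back in [y], has value at most its position. *)
Lemma vcode_gap m A B i : vcode m A B -> 1 < m -> i <= size A ->
  nth 0 (0 :: B) i + 2 <= nth 0 (rcons A m) i.
Proof.
move=> v m2 hi; have [sA sB] := vcode_sorted v; have [rA rB] := vcode_range v.
have [sz _ _ gt] := v; case: i hi => [|i] hi /=.
  case: A {sA sz gt hi v} rA => [|a A] rA //=.
  by have := rA a (mem_head _ _); lia.
have g := gt i hi; rewrite nth_rcons; case: (ltngtP i.+1 (size A)) hi => // hi _.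
  have : nth 0 A i < nth 0 A i.+1.
    by apply: (sorted_ltn_nth ltn_trans); rewrite ?inE //; lia.
  by lia.
by have : 1 < nth 0 A i < m := rA _ (mem_nth 0 _); rewrite -hi => /(_ (ltnSn _)); lia.
Qed.

Section Forward.

Variables (m : nat) (A B A' B' y : seq nat).
Hypotheses (v : vcode m A B) (v' : vcode m A' B') (py : perm_eq y (iota 1 m)).
Hypothesis hP : forall i, i <= size A -> nth 0 y (nth 0 (0 :: B) i) = nth 0 (rcons A m) i.
Hypothesis hL : forall i p, i < size A -> p < nth 0 B i -> nth 0 y p <= nth 0 A i.
Hypothesis hQ : forall i, i <= size A' -> nth 0 (rc y) (nth 0 (0 :: B') i) = nth 0 (rcons A' m) i.

(* For the last clause of [compat]: among the first [d] letters of [y] and the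
   letters of [y] at positions >= [d] prescribed by [B'], those of size at most
   [a] are distinct elements of 1..a, and they include the first [d]. *)
Lemma compat_word : compat m A B A' B'.
Proof.
have [rA rB] := vcode_range v; have [rA' rB'] := vcode_range v'.
have [sz _ _ gt] := v; have [sz' _ _ _] := v'; have m0 := vcode_gt0 v.
have [_ sB'] := vcode_sorted v'.
have szy := size_word py.
have memB0 (b : nat) : b \in 0 :: B -> b < m.
  by rewrite inE => /predU1P[->//|/rB]; lia.
have memB0' (b : nat) : b \in 0 :: B' -> b < m.
  by rewrite inE => /predU1P[->//|/rB']; lia.
have B0lt i : nth 0 (0 :: B') i < m.
  have [hi|hi] := ltnP i (size (0 :: B')); last by rewrite nth_default.
  exact/memB0'/mem_nth.
have B0lt1 i : nth 0 (0 :: B) i < m.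
  have [hi|hi] := ltnP i (size (0 :: B)); last by rewrite nth_default.
  exact/memB0/mem_nth.
(* The records of [rc y] read in [y]: positions are reflected by [m.-1], values by [m.+1]. *)
have hQ' i : i <= size A' ->
    nth 0 y (m.-1 - nth 0 (0 :: B') i) = m.+1 - nth 0 (rcons A' m) i.
  move=> hi; rewrite -hQ // nth_rc szy ?B0lt //.
  have /(nth_word py) : m.-1 - nth 0 (0 :: B') i < m by lia.
  by lia.
have dA (a : nat) : a \in A -> m.+1 - a \notin A'.
  move=> aA; apply/negP => aA'; have ra : 1 < a < m := rA a aA.
  have m2 : 1 < m by lia.
  have hi : index a A < size A by rewrite index_mem.
  have hj : index (m.+1 - a) A' < size A' by rewrite index_mem.
  have := hP (ltnW hi); have := hQ' _ (ltnW hj).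
  have := vcode_gap v m2 (ltnW hi); have := vcode_gap v' m2 (ltnW hj).
  rewrite !nth_rcons hi hj !nth_index // subKn; last by lia.
  set i := nth 0 (0 :: B) _; set j := nth 0 (0 :: B') _ => g' g E1 E2.
  have /eqP : nth 0 y i = nth 0 y (m.-1 - j) by rewrite E1 E2.
  have hi' : i < size y by rewrite szy B0lt1.
  have hj' : m.-1 - j < size y by rewrite szy; move: m0; clear; lia.
  by rewrite (nth_uniq 0 hi' hj' (uniq_word py)) => /eqP; move: g g' ra; clear; lia.
have dB (d : nat) : d \in B -> m.-1 - d \notin B'.
  move=> dB; apply/negP => dB'; have rd : 0 < d < m.-1 := rB d dB.
  have hm : 1 < m by lia.
  have hi : index d B < size A by rewrite sz index_mem.
  have hj : index (m.-1 - d) B' < size A' by rewrite sz' index_mem.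
  have := hP hi; have := hQ' _ hj.
  have := vcode_gap v hm hi; have := vcode_gap v' hm hj.
  rewrite /= !nth_index // subKn; last by lia.
  by move=> g' g -> E; move: g g' E rd; clear; lia.
split=> //.
move=> r hr; set d := nth 0 B r; set a := nth 0 A r.
have /andP[d1 dm] : 0 < d < m.-1 by apply/rB/mem_nth; rewrite -sz.
have /andP[a1 am] : 1 < a < m by apply/rA/mem_nth.
(* [T] holds the records of [rc y] whose reflected position is at least [d]; 0 stands for the last
   letter of [y]. *)
pose T := [seq b <- 0 :: B' | b <= m.-1 - d].
pose L := map (nth 0 y) (iota 0 d ++ map (subn m.-1) T).
have uB' : uniq (0 :: B').
  by rewrite /= sorted_uniq_ltn // andbT; apply/negP => /rB'.
have leB' b : b \in 0 :: B' -> b <= m.-1.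
  by rewrite inE => /predU1P[->//|/rB']; lia.
have uL : uniq L.
  rewrite map_inj_in_uniq; last first.
    move=> p q; rewrite !mem_cat => hp hq /eqP; rewrite nth_uniq ?(uniq_word py) //.
    - by move/eqP.
    - rewrite szy; case/orP: hp => [|/mapP[b _ ->]]; rewrite ?mem_iota; lia.
    - rewrite szy; case/orP: hq => [|/mapP[b _ ->]]; rewrite ?mem_iota; lia.
  rewrite cat_uniq iota_uniq map_inj_in_uniq ?filter_uniq ?andbT //; last first.
    by move=> b c; rewrite !mem_filter => /andP[_ /leB' hb] /andP[_ /leB' hc]; lia.
  apply/hasPn => p /mapP[b]; rewrite mem_filter => /andP[hb _] ->.
  by rewrite mem_iota; lia.
have le1 : count (geq a) L <= a.
  rewrite -size_filter -[X in _ <= X](size_iota 1); apply: uniq_leq_size.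
    exact: filter_uniq.
  move=> x; rewrite mem_filter mem_iota => /andP[xa /mapP[p hp Ex]].
  have /(nth_word py) : p < m.
    by move: hp; rewrite mem_cat => /orP[|/mapP[b _ ->]]; rewrite ?mem_iota; lia.
  by rewrite -Ex; move: xa => /=; lia.
(* A reflected value above [a] comes from an entry of [A'] below [m.+1 - a]; the final record [m]
   reflects to 1 and never counts. *)
have cX : count (predC (geq a)) (map (nth 0 y) (map (subn m.-1) T)) <= cle (m.+1 - a) A'.
  have EX : map (nth 0 y) (map (subn m.-1) (0 :: B')) = map (subn m.+1) (rcons A' m).
    apply: (@eq_from_nth _ 0) => [|i]; rewrite !size_map; first by rewrite size_rcons sz'.
    move=> hi; rewrite -map_comp (nth_map 0) // (nth_map 0) ?size_rcons ?sz' //.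
    by apply: hQ'; rewrite sz'.
  apply: (@leq_trans (count (predC (geq a)) (map (nth 0 y) (map (subn m.-1) (0 :: B'))))).
    rewrite !count_map count_filter; apply: sub_count => x /= /andP[]//.
  rewrite EX count_map -cats1 count_cat /= addn0 (_ : _ - m <= a); last by lia.
  by rewrite addn0; apply: sub_count => x /=; lia.
have sT : size T = (cle (m.-1 - d) B').+1 by rewrite /T /= size_filter.
have c0 : count (geq a) (map (nth 0 y) (iota 0 d)) = d.
  rewrite -[RHS](size_iota 0) -[RHS](size_map (nth 0 y)).
  apply/eqP; rewrite -all_count; apply/allP => x /mapP[p]; rewrite mem_iota => hp ->.
  by apply: hL => //; lia.
have := count_predC (geq a) (map (nth 0 y) (map (subn m.-1) T)).
rewrite !size_map sT; move: le1; rewrite /L map_cat count_cat c0.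
move: cX; clear; lia.
Qed.

End Forward.

(** * From inequalities to words *)

Lemma ltn_count_sorted (s : seq nat) i d : sorted ltn s -> i < size s ->
  (nth 0 s i < d) = (i < count (gtn d) s).
Proof.
move=> ss hi; have hin := mem_nth 0 hi; have ix := index_uniq 0 hi (sorted_uniq_ltn ss).
apply/idP/idP => [lt|].
  have := index_sorted ss hin; rewrite ix => {1}->.
  rewrite -2!size_filter; have := @uniq_leq_size _ (nth 0 s i :: filter (gtn (nth 0 s i)) s) (filter (gtn d) s).
  apply; first by rewrite /= mem_filter /= ltnn /= filter_uniq ?sorted_uniq_ltn.
  move=> x; rewrite inE !mem_filter => /predU1P[->|/= /andP[lx ->]]; first by rewrite /= lt.
  by rewrite andbT (ltn_trans lx).
apply: contraLR; rewrite -!leqNgt => le.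
rewrite -ix (index_sorted ss hin); apply: sub_count => x /= lt.
exact: leq_trans le.
Qed.

Lemma cle_gtn a (s : seq nat) : cle a s = count (gtn a.+1) s.
Proof. by []. Qed.

Lemma cle_nth (s : seq nat) r : sorted ltn s -> r < size s -> cle (nth 0 s r) s = r.+1.
Proof.
move=> ss hr; apply/eqP; rewrite eqn_leq cle_gtn -ltn_count_sorted // leqnn andbT.
rewrite leqNgt; apply/negP => lt.
have hr1 : r.+1 < size s by apply: leq_trans lt (count_size _ _).
move: lt; rewrite -ltn_count_sorted // ltnS leqNgt => /negP; apply.
by apply: (sorted_ltn_nth ltn_trans).
Qed.

Lemma cle_pred_nth (s : seq nat) r : sorted ltn s -> r < size s -> 0 < nth 0 s r ->
  cle (nth 0 s r).-1 s = r.
Proof.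
move=> ss hr h0; rewrite cle_gtn prednK // -index_sorted ?mem_nth //.
by rewrite index_uniq ?sorted_uniq_ltn.
Qed.

(** Entries below a threshold form an initial segment, so an increasing matching respects two
    thresholds as soon as their counts compare. *)
Lemma sorted_matching (s t : seq nat) d a i : sorted ltn s -> sorted ltn t ->
  size s = size t -> count (gtn d) s <= count (gtn a) t ->
  i < size s -> nth 0 s i < d -> nth 0 t i < a.
Proof.
move=> ss st sz le hi; rewrite !ltn_count_sorted -?sz // => h.
exact: leq_trans le.
Qed.

Section Backward.

Variables (m : nat) (A B A' B' : seq nat).
Hypotheses (v : vcode m A B) (v' : vcode m A' B') (m2 : 1 < m).
Hypotheses (c : compat m A B A' B') (c' : compat m A' B' A B).

(* [Sp] and [Sv] list the prescribed positions and values in corresponding order;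
   [Mp] and [Mv] list the free ones increasingly, so that sending the t-th entry
   of [pp] to the t-th entry of [vv] matches the free ones monotonically. *)
Let Sp := (0 :: B) ++ map (subn m.-1) (0 :: B').
Let Sv := rcons A m ++ map (subn m.+1) (rcons A' m).
Let Mp : seq nat := [seq p <- iota 0 m | p \notin Sp].
Let Mv : seq nat := [seq v <- iota 1 m | v \notin Sv].
Let pp := Sp ++ Mp.
Let vv := Sv ++ Mv.

Local Lemma memB (b : nat) : b \in B -> 0 < b < m.-1.
Proof. by move=> h; have [_ ->] := vcode_range v. Qed.
Local Lemma memB' (b : nat) : b \in B' -> 0 < b < m.-1.
Proof. by move=> h; have [_ ->] := vcode_range v'. Qed.
Local Lemma memA (b : nat) : b \in A -> 1 < b < m.
Proof. by move=> h; have [->] := vcode_range v. Qed.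
Local Lemma memA' (b : nat) : b \in A' -> 1 < b < m.
Proof. by move=> h; have [->] := vcode_range v'. Qed.
Local Lemma szAB : size A = size B. Proof. by case: v. Qed.
Local Lemma szAB' : size A' = size B'. Proof. by case: v'. Qed.

Local Lemma uniqB0 m0 A0 B0 : vcode m0 A0 B0 -> uniq (0 :: B0).
Proof.
move=> v0; have [_ sB] := vcode_sorted v0; have [_ rB] := vcode_range v0.
by rewrite /= sorted_uniq_ltn // andbT; apply/negP => /rB.
Qed.

Local Lemma uniqAm m0 A0 B0 : vcode m0 A0 B0 -> uniq (rcons A0 m0).
Proof. by case=> _ p _ _; apply/sorted_uniq_ltn/(path_sorted p). Qed.

Local Lemma memB0 (b : nat) : b \in 0 :: B -> b < m.-1.
Proof. by rewrite inE => /predU1P[->|/memB]; lia. Qed.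
Local Lemma memB0' (b : nat) : b \in 0 :: B' -> b < m.-1.
Proof. by rewrite inE => /predU1P[->|/memB']; lia. Qed.
Local Lemma memAm (b : nat) : b \in rcons A m -> 1 < b <= m.
Proof. by rewrite mem_rcons inE => /predU1P[->|/memA]; lia. Qed.
Local Lemma memAm' (b : nat) : b \in rcons A' m -> 1 < b <= m.
Proof. by rewrite mem_rcons inE => /predU1P[->|/memA']; lia. Qed.

Local Lemma uniq_Sp : uniq Sp.
Proof.
rewrite cat_uniq (uniqB0 v) map_inj_in_uniq ?(uniqB0 v') ?andbT /=; last first.
  by move=> x y /memB0' hx /memB0' hy; lia.
have [_ nB _] := c.
apply/negP => /orP[|/hasP[x /mapP[b hb ->]]].
  by rewrite inE subn0 => /predU1P[|/memB]; lia.
have rb := memB' hb; rewrite inE => /predU1P[|hB]; first by lia.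
by have := nB _ hB; rewrite subKn ?hb //; lia.
Qed.

Local Lemma uniq_Sv : uniq Sv.
Proof.
rewrite cat_uniq (uniqAm v) map_inj_in_uniq ?(uniqAm v') ?andbT /=; last first.
  by move=> x y /memAm' hx /memAm' hy; lia.
have [nA _ _] := c.
apply/negP => /hasP[x /mapP[a]]; rewrite mem_rcons inE => /predU1P[->|ha] ->.
  by move/memAm; lia.
have ra := memA' ha; rewrite mem_rcons inE => /predU1P[|hA]; first by lia.
by have := nA _ hA; rewrite subKn ?ha //; lia.
Qed.

Local Lemma perm_cat_compl (T S : seq nat) : uniq T -> uniq S -> {subset S <= T} ->
  perm_eq T (S ++ [seq x <- T | x \notin S]).
Proof.
by move=> uT uS ST; have := @perm_compl T S id uT uS; rewrite map_id; apply.
Qed.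

Local Lemma perm_pp : perm_eq (iota 0 m) pp.
Proof.
apply: perm_cat_compl (iota_uniq _ _) uniq_Sp _ => x; rewrite mem_iota mem_cat.
by case/orP => [/memB0|/mapP[b /memB0' hb ->]]; lia.
Qed.

Local Lemma perm_vv : perm_eq (iota 1 m) vv.
Proof.
apply: perm_cat_compl (iota_uniq _ _) uniq_Sv _ => x; rewrite mem_iota mem_cat.
by case/orP => [/memAm|/mapP[b /memAm' hb ->]]; lia.
Qed.

Local Lemma size_Sp : size Sp = (size A).+1 + (size A').+1.
Proof. by rewrite size_cat size_map /= szAB szAB'. Qed.
Local Lemma size_Sv : size Sv = (size A).+1 + (size A').+1.
Proof. by rewrite size_cat size_map !size_rcons. Qed.
Local Lemma size_pp : size pp = m.
Proof. by rewrite -(perm_size perm_pp) size_iota. Qed.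
Local Lemma size_vv : size vv = m.
Proof. by rewrite -(perm_size perm_vv) size_iota. Qed.
Local Lemma size_Mpv : size Mp = size Mv.
Proof.
by apply/eqP; rewrite -(eqn_add2l (size Sp)) {2}size_Sp -size_Sv -!size_cat size_pp size_vv.
Qed.

(** Positions below [d] are free, prescribed by [0 :: B], or reflected from entries of [B'] above
    [m.-1 - d]. The reflection of 0 is the last position, which is not below [d]. *)
Local Lemma countMp d : 0 < d < m ->
  count (gtn d) Mp + (cle d.-1 B).+1 + size A' = d + cle (m.-1 - d) B'.
Proof.
move=> hd; have /seq.permP/(_ (gtn d)) := perm_pp.
rewrite count_gtn_iota !count_cat count_map /= subn0 (_ : minn _ _ = d); last by lia.
have -> : count (gtn d) B = cle d.-1 B by apply: eq_count => x /=; lia.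
have -> : count (preim (subn m.-1) (gtn d)) B' = count (predC (geq (m.-1 - d))) B'.
  by apply: eq_in_count => x /memB' /=; lia.
rewrite szAB' -(count_predC (geq (m.-1 - d)) B') /cle.
have -> : (0 < d) = true by lia.
have -> : (m.-1 - 0 < d) = false by lia.
by move=> /= E; move: E; clear; lia.
Qed.

Local Lemma countMv a : 0 < a < m ->
  count (geq a) Mv + cle a A + (size A').+1 = a + cle (m - a) A'.
Proof.
move=> ha; have /seq.permP/(_ (gtn a.+1)) := perm_vv.
rewrite count_gtn_iota (_ : minn _ _ = a); last by lia.
rewrite (@eq_count _ (gtn a.+1) (geq a)) ?ltnS // /vv /Sv !count_cat count_map.
rewrite -!cats1 !count_cat -/(cle a A) /=.
have -> : count (preim (subn m.+1) (geq a)) A' = count (predC (geq (m - a))) A'.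
  by apply: eq_in_count => x /memA' /=; lia.
rewrite -(count_predC (geq (m - a)) A') /cle.
have -> : (m <= a) = false by lia.
have -> : (m.+1 - m <= a) = true by lia.
by move=> /= E; move: E; clear; lia.
Qed.

(** The code of [P] prescribes r+1 positions below B_r and r+1 values at most A_r. These cancel, so
    the Hall inequality in [c] is the comparison of counts that [sorted_matching] needs. *)
Local Lemma matchP r s : r < size A -> s < size Mp ->
  nth 0 Mp s < nth 0 B r -> nth 0 Mv s <= nth 0 A r.
Proof.
move=> hr hs; have hrB := hr; rewrite szAB in hrB.
have rd : 0 < nth 0 B r < m.-1 := memB (mem_nth 0 hrB).
have ra : 1 < nth 0 A r < m := memA (mem_nth 0 hr).
have [sA sB] := vcode_sorted v; have [nA _ /(_ r hr) H] := c.
move=> lt; rewrite -ltnS; apply: sorted_matching lt => //.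
- by apply: sorted_filter (iota_ltn_sorted _ _); apply: ltn_trans.
- by apply: sorted_filter (iota_ltn_sorted _ _); apply: ltn_trans.
- exact: size_Mpv.
rewrite (@eq_count _ (gtn (nth 0 A r).+1) (geq (nth 0 A r))) //.
have := @countMp (nth 0 B r); rewrite (_ : _ < _ < m); last by lia.
have := @countMv (nth 0 A r); rewrite (_ : _ < _ < m); last by lia.
rewrite cle_pred_nth ?(andP rd).1 // cle_nth //.
have := nA _ (mem_nth 0 hr).
have -> : m.+1 - nth 0 A r = (m - nth 0 A r).+1 by lia.
move=> /cleS_notin h; rewrite subSn in H; last by lia.
rewrite h in H; move=> /(_ isT) E1 /(_ isT) E2.
by move: ra rd H E1 E2; clear; lia.
Qed.

(** Read in [y], the condition of [Q] bounds free letters from below. By contraposition small free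
    values must sit at small positions, so the matching is used from values to positions, with
    [c']. *)
Local Lemma matchP' r s : r < size A' -> s < size Mp ->
  m.-1 - nth 0 B' r < nth 0 Mp s -> m.+1 - nth 0 A' r <= nth 0 Mv s.
Proof.
move=> hr hs; have hrB := hr; rewrite szAB' in hrB.
have rd : 0 < nth 0 B' r < m.-1 := memB' (mem_nth 0 hrB).
have ra : 1 < nth 0 A' r < m := memA' (mem_nth 0 hr).
have [sA sB] := vcode_sorted v'; have [nA _ /(_ r hr) H] := c'.
rewrite ltnNge (leqNgt (m.+1 - _)); apply: contraNN => lt; rewrite -ltnS.
apply: sorted_matching lt => //.
- by apply: sorted_filter (iota_ltn_sorted _ _); apply: ltn_trans.
- by apply: sorted_filter (iota_ltn_sorted _ _); apply: ltn_trans.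
- by rewrite size_Mpv.
- rewrite (@eq_count _ (gtn (m.+1 - nth 0 A' r)) (geq (m - nth 0 A' r))); last first.
    by move=> x /=; lia.
  have := @countMp (m.-1 - nth 0 B' r).+1; rewrite (_ : _ < _ < m); last by lia.
  have := @countMv (m - nth 0 A' r); rewrite (_ : _ < _ < m); last by lia.
  have -> : m.-1 - (m.-1 - nth 0 B' r).+1 = (nth 0 B' r).-1 by lia.
  have -> : m - (m - nth 0 A' r) = nth 0 A' r by lia.
  rewrite cle_pred_nth ?(andP rd).1 // cle_nth //.
  have := nA _ (mem_nth 0 hr).
  have -> : m.+1 - nth 0 A' r = (m - nth 0 A' r).+1 by lia.
  move=> /cleS_notin h; rewrite subSn in H; last by lia.
  rewrite h in H; move=> /(_ isT) E1 /(_ isT) E2; rewrite /= in E2.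
  have := szAB; have := szAB'.
  by move: ra rd H E1 E2; clear; lia.
by rewrite -size_Mpv.
Qed.

Let y := [seq nth 0 vv (index p pp) | p <- iota 0 m].

Local Lemma perm_y : perm_eq y (iota 1 m).
Proof.
rewrite /y (permPl (perm_map _ perm_pp)) (permPr perm_vv).
rewrite (_ : map _ pp = vv) //; apply: (@eq_from_nth _ 0); rewrite size_map ?size_pp ?size_vv // => i hi.
by rewrite (nth_map 0) ?index_uniq ?size_pp // -(perm_uniq perm_pp) iota_uniq.
Qed.

Local Lemma size_y : size y = m.
Proof. by rewrite size_map size_iota. Qed.

Local Lemma nth_y t : t < m -> nth 0 y (nth 0 pp t) = nth 0 vv t.
Proof.
move=> ht; have hp : nth 0 pp t < m.
  have : nth 0 pp t \in pp by rewrite mem_nth ?size_pp.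
  by rewrite -(perm_mem perm_pp) mem_iota.
rewrite (nth_map 0) ?size_iota // nth_iota // index_uniq ?size_pp //.
by rewrite -(perm_uniq perm_pp) iota_uniq.
Qed.

Local Lemma pvP p : p < m ->
  [\/ exists2 i, i <= size A & p = nth 0 (0 :: B) i /\ nth 0 y p = nth 0 (rcons A m) i,
      exists2 j, j <= size A' & p = m.-1 - nth 0 (0 :: B') j /\
                               nth 0 y p = m.+1 - nth 0 (rcons A' m) j |
      exists2 s, s < size Mp & p = nth 0 Mp s /\ nth 0 y p = nth 0 Mv s].
Proof.
move=> hp; have ppp : p \in pp by rewrite -(perm_mem perm_pp) mem_iota.
have ht : index p pp < m by rewrite -size_pp index_mem.
have := nth_y ht; rewrite nth_index // => ->; rewrite -{1 3 5}(nth_index 0 ppp).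
set t := index p pp in ht *; rewrite /pp /vv !nth_cat size_Sp size_Sv.
case: ltnP => ht1; last first.
  constructor 3; exists (t - size Sp); rewrite ?size_Sp //.
  by have := size_pp; rewrite size_cat size_Sp; move: ht ht1; clear; lia.
rewrite /= size_rcons -szAB.
case: ltnP => ht2; first by constructor 1; exists t.
constructor 2; exists (t - (size A).+1); first by lia.
by rewrite -map_cons !(nth_map 0) ?size_rcons //= -?szAB'; lia.
Qed.

Local Lemma ltB0_leA m0 (A0 B0 : seq nat) t r : vcode m0 A0 B0 -> t <= size A0 -> r < size A0 ->
  nth 0 (0 :: B0) t < nth 0 B0 r -> nth 0 (rcons A0 m0) t <= nth 0 A0 r.
Proof.
move=> v0 ht hr lt; have [sA sB] := vcode_sorted v0; have [sz _ _ _] := v0.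
have tr : t <= r.
  case: t ht lt => // t ht /= lt; rewrite ltnNge; apply/negP => rt.
  by have := leq_nth sB rt; rewrite -sz => /(_ ht); rewrite leqNgt lt.
by rewrite nth_rcons (leq_ltn_trans tr hr) leq_nth.
Qed.

Local Lemma y_pointP i : i <= size A -> nth 0 y (nth 0 (0 :: B) i) = nth 0 (rcons A m) i.
Proof.
move=> hi; have := @nth_y i; rewrite /pp /vv !nth_cat size_Sp size_Sv.
have -> : i < (size A).+1 + (size A').+1 by rewrite ltn_addr.
rewrite size_rcons [size (_ :: _)]/= -szAB ltnS hi; apply.
by rewrite -size_pp size_cat size_Sp; lia.
Qed.

Local Lemma y_pointQ i : i <= size A' ->
  nth 0 y (m.-1 - nth 0 (0 :: B') i) = m.+1 - nth 0 (rcons A' m) i.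
Proof.
move=> hi; have := @nth_y ((size A).+1 + i); rewrite /pp /vv !nth_cat size_Sp size_Sv.
rewrite ltn_add2l ltnS hi size_rcons [size (_ :: _)]/= -szAB.
have -> : ((size A).+1 + i < (size A).+1) = false by lia.
have hB : i < size (0 :: B') by rewrite /= -szAB'.
have hA : i < size (rcons A' m) by rewrite size_rcons.
rewrite addKn (nth_map 0 0 (subn m.-1) hB) (nth_map 0 0 (subn m.+1) hA); apply.
by rewrite -[X in _ < X]size_pp size_cat size_Sp; lia.
Qed.

Local Lemma y_leP r p : r < size A -> p < nth 0 B r -> nth 0 y p <= nth 0 A r.
Proof.
move=> hr lt; have rd : 0 < nth 0 B r < m.-1 by apply/memB/mem_nth; rewrite -szAB.
have ar : nth 0 B r < nth 0 A r by case: v => _ _ _; apply.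
have pm : p < m by lia.
case: (pvP pm) => [[i hi [Ep ->]]|[j hj [Ep ->]]|[s hs [Ep ->]]].
- by apply: (ltB0_leA v); rewrite -?Ep.
(* A reflected record of the second path has value at most its position [p], and p < B_r < A_r. *)
- by have := vcode_gap v' m2 hj; lia.
- by apply: matchP; rewrite -?Ep.
Qed.

Local Lemma y_leQ r p : r < size A' -> p < nth 0 B' r -> nth 0 (rc y) p <= nth 0 A' r.
Proof.
move=> hr lt; have rd : 0 < nth 0 B' r < m.-1 by apply/memB'/mem_nth; rewrite -szAB'.
have ra : 1 < nth 0 A' r < m by apply/memA'/mem_nth.
have ar : nth 0 B' r < nth 0 A' r by case: v' => _ _ _; apply.
have pm : m.-1 - p < m by lia.
rewrite nth_rc size_y; last by lia.
case: (pvP pm) => [[i hi [Ep ->]]|[j hj [Ep ->]]|[s hs [Ep ->]]].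
- by have := vcode_gap v m2 hi; lia.
- have hB : nth 0 (0 :: B') j < m.-1 by apply/memB0'/mem_nth; rewrite /= -szAB'.
  have hA : 1 < nth 0 (rcons A' m) j <= m by apply/memAm'/mem_nth; rewrite size_rcons.
  have := @ltB0_leA m A' B' j r v' hj hr.
  by move: Ep hB hA lt rd; clear; lia.
- have := @matchP' r s hr hs; rewrite -Ep.
  by move: rd ra lt; clear; lia.
Qed.

Lemma word_of_compat : exists y, [/\ perm_eq y (iota 1 m),
  mu_aux 0 y = path_of_code m A B & mu_aux 0 (rc y) = path_of_code m A' B'].
Proof.
exists y; split; first exact: perm_y.
  by apply/(mu_code perm_y v); split; [exact: y_pointP | exact: y_leP].
apply/(mu_code (perm_rc perm_y) v'); split; last exact: y_leQ.
move=> i hi; have hB : nth 0 (0 :: B') i < m.-1 by apply/memB0'/mem_nth; rewrite /= -szAB'.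
have hA : 1 < nth 0 (rcons A' m) i <= m by apply/memAm'/mem_nth; rewrite size_rcons.
by rewrite nth_rc size_y ?y_pointQ //; lia.
Qed.

End Backward.

(** * The irreducible case *)

Lemma prime_pair m P Q : prime_dyck m P -> prime_dyck m Q ->
  (exists y, [/\ perm_eq y (iota 1 m), mu_aux 0 y = P & mu_aux 0 (rc y) = Q]) <->
  le_irr (Lp_irr Q) P /\ le_irr (Lp_irr P) Q.
Proof.
move=> pP pQ; have [vP EP] := prime_code pP; have [vQ EQ] := prime_code pQ.
rewrite (le_Lp_irr pP pQ) (le_Lp_irr pQ pP).
split=> [[y [py yP yQ]]|[cPQ cQP]].
  rewrite EP in yP; rewrite EQ in yQ.
  have [hP hPl] := (mu_code py vP).1 yP.
  have pry := perm_rc py; have [hQ hQl] := (mu_code pry vQ).1 yQ.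
  split; first exact: (compat_word vP vQ py).
  (* As [rc] is an involution, the same argument for [rc y] gives the other inequality. *)
  by apply: (compat_word vQ vP pry); rewrite ?(rcK py).
have [m1|m2] := leqP m 1; last by rewrite EP EQ; apply: word_of_compat.
(* The only letter is prescribed by both paths, so [word_of_compat] does not apply. *)
have Em : m = 1 by have := vcode_gt0 vP; lia.
have nil A B : vcode m A B -> A = [::] /\ B = [::].
  move=> v; have [rA rB] := vcode_range v; split.
    by case: (A) rA => // a t /(_ a (mem_head _ _)); lia.
  by case: (B) rB => // a t /(_ a (mem_head _ _)); lia.
by exists [:: 1]; rewrite EP EQ Em; have [-> ->] := nil _ _ vP; have [-> ->] := nil _ _ vQ.
Qed.

(** * Direct sums of words *)

Lemma uniq_perm_iota n (s : seq nat) : uniq s -> {in s, forall x, 0 < x <= n} ->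
  size s = n -> perm_eq s (iota 1 n).
Proof.
move=> us rs sz; apply: uniq_perm; rewrite ?iota_uniq //.
have sub : {subset s <= iota 1 n} by move=> x /rs; rewrite mem_iota; lia.
by have [_] := uniq_min_size us sub (eq_leq (etrans (size_iota _ _) (esym sz))).
Qed.

Lemma nD_mu c s : nD (mu_aux c s) = size s.
Proof.
elim: s c => //= x s IH c; case: ifP => _; last by rewrite nD_cons IH.
by rewrite nD_cat nD_nseq nD_cons IH.
Qed.

Lemma nU_mu_le c M s : c <= M -> all (geq M) s -> c + nU (mu_aux c s) <= M.
Proof.
elim: s c => [|x s IH] c cM; first by rewrite addn0.
move=> /andP[xM aM] /=; case: ltnP => cx; last by rewrite nU_cons IH.
by rewrite nU_cat nU_nseq nU_cons mul1n add0n addnA subnKC ?(ltnW cx) ?IH.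
Qed.

Lemma mu_prefix c s i : let q := take i (mu_aux c s) in
  all (geq (c + nU q)) (take (nD q) s).
Proof.
elim: s c i => [|x s IH] c i /=; first by [].
case: ltnP => cx.
  rewrite take_cat size_nseq; case: ltnP => hi.
    by rewrite take_nseq_min nD_nseq.
  case E : (i - (x - c)) => [|j] /=; first by rewrite cats0 nD_nseq.
  rewrite nU_cat nD_cat nU_nseq nD_nseq nU_cons nD_cons mul1n mul0n add0n add1n /=.
  rewrite addnA subnKC ?(ltnW cx) // add0n; apply/andP; split; first by rewrite leq_addr.
  exact: IH.
case: i => [|i] //=; rewrite !add0n.
by rewrite (leq_trans cx (leq_addr _ _)); apply: IH.
Qed.

(** By [mu_prefix], the letters read by a prefix are distinct positive numbers bounded by its number
    of up steps, so its down steps cannot outnumber its up steps. *)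
Lemma mu_dyck n y : perm_eq y (iota 1 n) -> dyck n (mu_aux 0 y).
Proof.
move=> py; have H i : nD (take i (mu_aux 0 y)) <= nU (take i (mu_aux 0 y)).
  set q := take i _; have /= := mu_prefix 0 y i; rewrite -/q ?add0n => h.
  have hs : nD q <= size y.
    by rewrite -(nD_mu 0 y) -[X in _ <= nD X](cat_take_drop i) nD_cat leq_addr.
  rewrite -{1}(size_takel hs) -[X in _ <= X](size_iota 1); apply: uniq_leq_size.
    by rewrite take_uniq ?(uniq_word py).
  move=> x xt; rewrite mem_iota; have /(_ x xt) /= := allP h.
  by have := mem_take xt; rewrite (mem_word py); lia.
have nDn : nD (mu_aux 0 y) = n by rewrite nD_mu (size_word py).
have nUn : nU (mu_aux 0 y) = n.
  apply/eqP; rewrite eqn_leq; apply/andP; split.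
    rewrite -[X in X <= _]add0n; apply: nU_mu_le => //.
    by apply/allP => x; rewrite (mem_word py) => /andP[].
  by have := H (size (mu_aux 0 y)); rewrite take_size nDn.
by split; rewrite // ?nUn ?nDn // size_nUD nUn nDn addnn.
Qed.

Lemma mu_aux_cat c s t :
  mu_aux c (s ++ t) = mu_aux c s ++ mu_aux (c + nU (mu_aux c s)) t.
Proof.
elim: s c => [|x s IH] c /=; first by rewrite addn0.
case: ltnP => cx; rewrite IH ?nU_cons //= -catA nU_cat nU_nseq nU_cons mul1n.
by rewrite add0n addnA subnKC // ltnW.
Qed.

Lemma mu_aux_shift k c s : mu_aux (k + c) (map (addn k) s) = mu_aux c s.
Proof. by elim: s c => //= x s IH c; rewrite ltn_add2l subnDl !IH. Qed.

Definition dsum k (y1 y2 : seq nat) := y1 ++ map (addn k) y2.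

Section DirectSum.

Variables (k l : nat) (y1 y2 : seq nat).
Hypotheses (p1 : perm_eq y1 (iota 1 k)) (p2 : perm_eq y2 (iota 1 l)).

Lemma perm_dsum : perm_eq (dsum k y1 y2) (iota 1 (k + l)).
Proof.
rewrite iotaD /dsum (permPl (perm_cat p1 (perm_map _ p2))) addnC iotaDl.
by rewrite perm_refl.
Qed.

Lemma mu_dsum : mu_aux 0 (dsum k y1 y2) = mu_aux 0 y1 ++ mu_aux 0 y2.
Proof.
rewrite mu_aux_cat; have [sz bal _] := mu_dyck p1.
have -> : nU (mu_aux 0 y1) = k by have := size_nUD (mu_aux 0 y1); lia.
by rewrite add0n -(mu_aux_shift k 0 y2) addn0.
Qed.

Lemma rc_dsum : rc (dsum k y1 y2) = dsum l (rc y2) (rc y1).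
Proof.
rewrite /rc /dsum size_cat size_map (size_word p1) (size_word p2) map_cat rev_cat.
congr (_ ++ _); last rewrite map_rev; congr rev; rewrite -map_comp.
  by apply: eq_map => x /=; lia.
by apply/eq_in_map => x; rewrite (mem_word p1) /=; lia.
Qed.

End DirectSum.

Lemma cat_eq_block X Y j t : last D X = D -> X != [::] -> X ++ Y = nseq j U ++ D :: t ->
  exists X', [/\ X = nseq j U ++ D :: X', last D X' = D & t = X' ++ Y].
Proof.
elim: j X => [|j IH] [|b X] //= lX _ [Eb E]; rewrite {b}Eb in lX *; first by exists X.
case: X lX E => [|e X] // lX E.
by have [X' [-> ? ?]] := IH (e :: X) lX isT E; exists X'.
Qed.

(** A prefix not ending in an up step stops between two letters: it has read [nD X] letters and
    raised the running maximum by [nU X]. *)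
Lemma mu_split c s X Y : last D X = D -> mu_aux c s = X ++ Y ->
  mu_aux c (take (nD X) s) = X /\ mu_aux (c + nU X) (drop (nD X) s) = Y.
Proof.
elim: s c X => [|x s IH] c X lX; first by case: X lX => // b X _; case: Y.
have [->|X0] := eqVneq X [::]; first by rewrite take0 drop0 addn0.
rewrite /=; case: ltnP => cx E.
  have [X' [EX lX' E']] := cat_eq_block lX X0 (esym E).
  have [IH1 IH2] := IH _ _ lX' E'.
  rewrite EX nD_cat nD_nseq nD_cons mul0n add0n add1n /= cx IH1; split=> //.
  by rewrite nU_cat nU_nseq nU_cons mul1n add0n addnA subnKC // ltnW.
have [X' [EX lX' E']] := @cat_eq_block X Y 0 _ lX X0 (esym E).
have [IH1 IH2] := IH _ _ lX' E'.
rewrite EX [nseq 0 U ++ _]/= nD_cons nU_cons add0n add1n /=.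
by rewrite ltnNge cx /= IH1.
Qed.

Lemma last_dyck k p : dyck k p -> last D p = D.
Proof.
case/lastP: p => // p b [_ bal /(_ (size p))]; rewrite last_rcons.
by rewrite -cats1 take_size_cat // in bal *; move: bal; rewrite nU_cat nD_cat;
   case: b => //=; rewrite /(nU [:: _]) /(nD [:: _]) /=; lia.
Qed.

Lemma nUD_dyck k p : dyck k p -> nU p = k /\ nD p = k.
Proof. by case=> sz bal _; have := size_nUD p; split; lia. Qed.

(** The first [k] letters are distinct and at most [k], because [X] has only [k] up steps; hence
    they are 1..k and [y] splits as a direct sum. *)
Lemma word_split n k y X Y : perm_eq y (iota 1 n) -> mu_aux 0 y = X ++ Y -> dyck k X ->
  exists y1 y2, [/\ y = dsum k y1 y2, perm_eq y1 (iota 1 k) & perm_eq y2 (iota 1 (n - k))] /\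
    (mu_aux 0 y1 = X /\ mu_aux 0 y2 = Y).
Proof.
move=> py E dX; have [nUX nDX] := nUD_dyck dX.
have [E1 E2] := mu_split (last_dyck dX) E; rewrite nUX nDX add0n in E1 E2.
have kn : k <= n by have := nD_mu 0 y; rewrite E nD_cat nDX (size_word py); lia.
have p1 : perm_eq (take k y) (iota 1 k).
  apply: uniq_perm_iota; first by rewrite take_uniq ?(uniq_word py).
    move=> x xt; have := mem_take xt; rewrite (mem_word py) => /andP[-> _] /=.
    have /= := mu_prefix 0 (take k y) (size (mu_aux 0 (take k y))).
    rewrite take_size nD_mu take_size E1 nUX => /allP/(_ x xt).
    by rewrite add0n.
  by rewrite size_takel ?(size_word py).
have p2 : perm_eq (drop k y) (map (addn k) (iota 1 (n - k))).
  rewrite -(perm_cat2l (take k y)) cat_take_drop (permPl py) -{1}(subnKC kn) iotaD.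
  by rewrite addnC iotaDl perm_cat2r perm_sym.
pose y2 := map (subn^~ k) (drop k y).
have Ey2 : drop k y = map (addn k) y2.
  rewrite -map_comp -[LHS]map_id; apply/eq_in_map => x.
  by rewrite (perm_mem p2) => /mapP[z _ ->] /=; lia.
exists (take k y), y2; split; split=> //.
- by rewrite /dsum -Ey2 cat_take_drop.
- by rewrite Ey2 in p2; apply: perm_map_inj p2; apply: addnI.
- by rewrite -[LHS](mu_aux_shift k) addn0 -Ey2.
Qed.

(** An interior return of the path of [rc y] splits [rc y] as a direct sum, hence also [y] with the
    summands exchanged, and the path of [y] would have an interior return. *)
Lemma prime_rc m y : perm_eq y (iota 1 m) -> prime_dyck m (mu_aux 0 y) ->
  prime_dyck m (mu_aux 0 (rc y)).
Proof.
move=> py [sz bal m0 H]; have pry := perm_rc py.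
have [szr balr Hr] := mu_dyck pry.
split=> // i /andP[i0 hi]; rewrite ltn_neqAle Hr andbT; apply/eqP => Ei.
have dX : dyck (nD (take i (mu_aux 0 (rc y)))) (take i (mu_aux 0 (rc y))).
  split; [by rewrite size_nUD -Ei addnn | by [] |] => j.
  have [ji|ij] := leqP j i; first by rewrite take_takel.
  by rewrite (@take_oversize _ j) ?size_take ?hi ?(ltnW ij) ?Ei.
set k := nD _ in Ei dX.
have [z1 [z2 [[Ez p1 p2] [E1 E2]]]] := word_split pry (esym (cat_take_drop i _)) dX.
have Ey : y = dsum (m - k) (rc z2) (rc z1) by rewrite -(rcK py) Ez (rc_dsum p1 p2).
have pz1 := perm_rc p1; have pz2 := perm_rc p2.
have := H (size (mu_aux 0 (rc z2))).
rewrite Ey (mu_dsum pz2 pz1) take_size_cat // size_cat.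
have [s1 b1 _] := mu_dyck pz1; have [s2 b2 _] := mu_dyck pz2.
have [sX bX _] := dX; rewrite size_takel ?(ltnW hi) // in sX.
rewrite s1 s2 b2 ltnn => H'; have : false by apply: H'; lia.
by [].
Qed.

(** * Pairing the irreducible components *)

Definition pair_ok P Q := le_irr (Lp_irr Q) P /\ le_irr (Lp_irr P) Q.

Lemma pair_ok_size P Q : is_prime_path P -> is_prime_path Q -> pair_ok P Q ->
  (size P)./2 = (size Q)./2.
Proof.
move=> pP pQ [le _]; have [pP' _] := le_irr_code (Lp_irr_prime pQ) le.
exact: is_prime_eq pP'.
Qed.

Lemma flatten_inj l l' : (forall s, s \in l -> is_prime_path s) ->
  (forall s, s \in l' -> is_prime_path s) -> flatten l = flatten l' -> l = l'.
Proof. by move=> pl pl' E; rewrite -(decomp_flatten pl) E decomp_flatten. Qed.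

(** [Qs] lists the components of the second path backwards, so that the i-th entries belong to the
    same direct summand. The length is left existential, since the induction removes a summand. *)
Lemma word_of_pairs (Ps Qs : seq (seq bool)) : (forall s, s \in Ps -> is_prime_path s) ->
  (forall s, s \in Qs -> is_prime_path s) ->
  (exists n y, [/\ perm_eq y (iota 1 n), mu_aux 0 y = flatten Ps &
                   mu_aux 0 (rc y) = flatten (rev Qs)]) <->
  size Ps = size Qs /\
  forall i, i < size Ps -> pair_ok (nth [::] Ps i) (nth [::] Qs i).
Proof.
elim: Ps Qs => [|P Ps IH] Qs pPs pQs.
  split=> [[n [y [py Ey ER]]]|[/esym/size0nil-> _]]; last by exists 0, [::].
  have y0 : y = [::] by apply: size0nil; rewrite -(nD_mu 0 y) Ey.
  have /(congr1 rev) : rev Qs = [::].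
    by apply: flatten_inj => // [s|]; [rewrite mem_rev; apply: pQs | rewrite -ER y0].
  by rewrite revK => ->; split.
have pP := pPs P (mem_head _ _).
have {}pPs s : s \in Ps -> is_prime_path s by move=> h; apply: pPs; rewrite inE h orbT.
split=> [[n [y [py Ey ER]]]|].
  have [y1 [y2 [[Ey12 p1 p2] [E1 E2]]]] := word_split py Ey (dyck_prime pP).
  have pq : prime_dyck (size P)./2 (mu_aux 0 (rc y1)) by apply: prime_rc; rewrite ?E1.
  have [l El pl] := dyck_flatten (mu_dyck (perm_rc p2)).
  (* By uniqueness of the factorisation, the last component of the second path is that of [rc y1], a
     single one by [prime_rc]. *)
  have EQ : Qs = mu_aux 0 (rc y1) :: rev l.
    rewrite -[LHS]revK -[RHS]revK; congr rev; apply: flatten_inj.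
    - by move=> s; rewrite mem_rev; apply: pQs.
    - move=> s; rewrite mem_rev inE mem_rev => /predU1P[->|/pl//].
      exact: prime_is_prime pq.
    rewrite -ER Ey12 (rc_dsum p1 p2) (mu_dsum (perm_rc p2) (perm_rc p1)).
    by rewrite rev_cons revK flatten_rcons El.
  have [] := (IH (rev l) pPs _).1; last first.
  - move=> szl H; rewrite EQ; split; [by rewrite /= szl | case=> [|i] hi; last exact: H].
    by apply/(prime_pair pP pq); exists y1.
  - by exists (n - (size P)./2), y2; rewrite revK.
  - by move=> s; rewrite mem_rev; apply: pl.
case: Qs pQs => [|Q Qs] pQs [] // [sz] H.
have pQ := pQs Q (mem_head _ _).
have {}pQs s : s \in Qs -> is_prime_path s by move=> h; apply: pQs; rewrite inE h orbT.
have ok := H 0 isT.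
have pQ' : prime_dyck (size P)./2 Q by rewrite (pair_ok_size pP pQ ok).
have [y1 [p1 E1 R1]] := (prime_pair pP pQ').2 ok.
have [n2 [y2 [p2 E2 R2]]] := (IH Qs pPs pQs).2 (conj sz (fun i => H i.+1)).
exists ((size P)./2 + n2), (dsum (size P)./2 y1 y2); split.
- exact: perm_dsum.
- by rewrite (mu_dsum p1 p2) E1 E2.
- by rewrite (rc_dsum p1 p2) (mu_dsum (perm_rc p2) (perm_rc p1)) R1 R2 rev_cons flatten_rcons.
Qed.

(** * From words to permutations *)

Lemma lambda_aux_mu N c (s : seq nat) : c <= N -> {in s, forall x, x <= N} ->
  lambda_aux c s = mu_aux (N - c) (map (subn N) s).
Proof.
elim: s c => //= x s IH c cN H.
have xN : x <= N by apply: H; rewrite mem_head.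
have {}H : {in s, forall z, z <= N} by move=> z zs; apply: H; rewrite inE zs orbT.
rewrite -!IH //; have -> : (N - c < N - x) = (x < c) by lia.
by case: ltnP => // xc; congr (nseq _ _ ++ _); lia.
Qed.

Lemma lambda_mu n (w : seq nat) : perm_eq w (iota 1 n) ->
  lambda w = mu_aux 0 (map (subn n.+1) w).
Proof.
move=> pw; rewrite /lambda (size_word pw) (@lambda_aux_mu n.+1) ?subnn // => x.
by rewrite (mem_word pw) => /andP[_ /leqW].
Qed.

Lemma word_perm n (a : 'S_n) : perm_eq (word a) (iota 1 n).
Proof.
apply: uniq_perm_iota; last by rewrite size_map size_enum_ord.
  rewrite map_inj_uniq ?enum_uniq // => i j [] /val_inj; exact: perm_inj.
by move=> x /mapP[i _ ->]; rewrite ltnS ltn_ord.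
Qed.

Lemma perm_word n (w : seq nat) : perm_eq w (iota 1 n) -> exists a : 'S_n, word a = w.
Proof.
move=> pw; have lt (i : 'I_n) : (nth 0 w i).-1 < n.
  by have := nth_word pw (ltn_ord i); lia.
have inj : injective (fun i => Ordinal (lt i)).
  move=> i j [] E.
  have hi : 0 < nth 0 w i <= n := nth_word pw (ltn_ord i).
  have hj : 0 < nth 0 w j <= n := nth_word pw (ltn_ord j).
  have Enth : nth 0 w i = nth 0 w j by lia.
  apply/val_inj/eqP; rewrite -(nth_uniq 0 _ _ (uniq_word pw)) ?(size_word pw) ?ltn_ord //.
  exact/eqP.
exists (perm inj); rewrite /word.
rewrite (eq_map (_ : _ =1 nth 0 w \o val)); last first.
  by move=> i /=; rewrite permE /=; have := nth_word pw (ltn_ord i); lia.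
by rewrite map_comp val_enum_ord -{2}(mkseq_nth 0 w) (size_word pw).
Qed.

Lemma decomp_Lp n p : dyck n p -> decomp (Lp p) = map Lp_irr (rev (decomp p)).
Proof.
move=> /dyck_decomp[_ pr]; rewrite /Lp -map_rev decomp_flatten // => s.
by case/mapP=> q; rewrite mem_rev => /pr pq ->; apply: prime_is_prime (Lp_irr_prime pq).
Qed.

Unset Implicit Arguments.

Theorem theorem7 (n : nat) (P Q : seq bool) :
  dyck n P -> dyck n Q ->
  ((exists alpha : 'S_n, lambda (word alpha) = P /\ mu (word alpha) = Q) <->
   (dle (Lp Q) P /\ dle (Lp P) Q)).
Proof.
move=> dP dQ; have [FP pP] := dyck_decomp dP; have [FQ pQ] := dyck_decomp dQ.
have pQ' s : s \in rev (decomp Q) -> is_prime_path s by rewrite mem_rev; apply: pQ.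
(* The components of [Q] enter reversed because [rc] reverses the order of direct summands. *)
have W := word_of_pairs pP pQ'; rewrite FP revK FQ size_rev in W.
have key : (exists alpha : 'S_n, lambda (word alpha) = P /\ mu (word alpha) = Q) <->
    exists n y, [/\ perm_eq y (iota 1 n), mu_aux 0 y = P & mu_aux 0 (rc y) = Q].
  have muE m (w : seq nat) : perm_eq w (iota 1 m) ->
      let y := map (subn m.+1) w in
      perm_eq y (iota 1 m) /\ lambda w = mu_aux 0 y /\ mu w = mu_aux 0 (rc y).
    move=> pw y; have E : rc w = rev y by rewrite /rc (size_word pw).
    have py : perm_eq y (iota 1 m) by rewrite -[y]revK -E perm_rev perm_rc.
    split=> //; split; first exact: lambda_mu.
    rewrite /mu; congr mu_aux; rewrite /rc (size_word py) -{1}(rcK pw) E /rc size_rev size_map (size_word pw).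
    by rewrite map_rev revK.
  split=> [[a [<- <-]]|[m [y [py Ey ER]]]].
    have [py [-> ->]] := muE _ _ (word_perm a).
    by exists n, (map (subn n.+1) (word a)).
  (* The path has one down step per letter, so [P] determines the length. *)
  have mn : m = n.
    by have [_ <-] := nUD_dyck dP; rewrite -Ey nD_mu (size_word py).
  rewrite {m}mn in py.
  have [py' [lE mE]] := muE _ _ py.
  have [a Ea] := perm_word py'; exists a; rewrite Ea.
  have [_ [-> ->]] := muE _ _ py'.
  suff -> : map (subn n.+1) (map (subn n.+1) y) = y by [].
  rewrite -map_comp -[RHS]map_id; apply/eq_in_map => x; rewrite (mem_word py) /=; lia.
rewrite key W /dle (decomp_Lp dP) (decomp_Lp dQ) !size_map !size_rev.
split=> [[sz H]|[[sz H1] [_ H2]]].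
  split; split=> // i hi.
    by rewrite (nth_map [::]) ?size_rev //; case: (H i _); rewrite // sz.
  (* [Lp P] lists the components of [P] backwards, so its index [i] belongs to the pair of index
     [size (decomp P) - i.+1]. *)
  rewrite (nth_map [::]) ?size_rev // nth_rev //.
  have hi' : size (decomp P) - i.+1 < size (decomp P) by lia.
  have [_] := H _ hi'; rewrite nth_rev; last by lia.
  by rewrite (_ : size (decomp Q) - _ = i) //; lia.
split=> // i hi; split.
  by have := H1 i; rewrite (nth_map [::]) ?size_rev sz //; apply.
have hi' : size (decomp P) - i.+1 < size (decomp P) by lia.
have := H2 _ hi'; rewrite (nth_map [::]) ?size_rev // !nth_rev -?sz //; try lia.
by rewrite (_ : size _ - (size _ - i.+1).+1 = i) //; lia.
Qed.
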